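(* Let $\ell \ge 4$ be an integer and let $\mathfrak g$ be the simple complex Lie algebra of type $D_\ell$. For every integer $n>0$, the vector $$v_n=\Big(\sum_{i=2}^{\ell} e_{\epsilon_1-\epsilon_i}(-1)\,e_{\epsilon_1+\epsilon_i}(-1)\Big)^n\mathbf 1$$ is a singular vector in the universal affine vertex algebra $N_{D_\ell}(n-\ell+1,0)$ of level $n-\ell+1$.
   Context: Realization of type $D_\ell$: $\mathfrak g=\{X\in \mathfrak{gl}_{2\ell}(\mathbb C): X^TJ+JX=0\}$ with $J=\begin{pmatrix}0&I_\ell\\ I_\ell&0\end{pmatrix}$. The Cartan subalgebra $\mathfrak h$ consists of the diagonal matrices in $\mathfrak g$, and $\epsilon_i\in\mathfrak h^*$ takes a diagonal matrix to its $i$-th diagonal entry ($1\le i\le \ell$). Positive roots are $\epsilon_i\pm\epsilon_j$ ($i<j$); simple roots are $\epsilon_i-\epsilon_{i+1}$ ($1\le i\le\ell-1$) and $\epsilon_{\ell-1}+\epsilon_\ell$; $\mathfrak n_+$ is the sum of the positive root spaces. With $E_{a,b}$ the matrix units, the root vectors for $i<j$ are $e_{\epsilon_i-\epsilon_j}=E_{i,j}-E_{\ell+j,\ell+i}$ and $e_{\epsilon_i+\epsilon_j}=E_{i,\ell+j}-E_{j,\ell+i}$. The invariant form is $(x,y)=\tfrac12\mathrm{tr}(xy)$, normalized so that roots have squared length $2$. Affine Lie algebra: $\hat{\mathfrak g}=\mathfrak g\otimes\mathbb C[t,t^{-1}]\oplus\mathbb CK$, $x(m)=x\otimes t^m$,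 $[x(m),y(r)]=[x,y](m+r)+m\,\delta_{m+r,0}(x,y)K$, $K$ central. For $k\in\mathbb C$, $N_{D_\ell}(k,0)=U(\hat{\mathfrak g})\otimes_{U(\mathfrak g\otimes\mathbb C[t]\oplus\mathbb CK)}\mathbb C$, where $\mathfrak g\otimes\mathbb C[t]$ acts by $0$ and $K$ by $k$ on $\mathbb C$; $\mathbf 1=1\otimes 1$ is the vacuum vector. This is the universal affine vertex algebra of level $k$. A singular vector is a nonzero weight vector annihilated by $\mathfrak n_+\otimes 1$ and by $\mathfrak g\otimes t\mathbb C[t]$. *)

(* Defs.v *)
From HB Require Import structures.
From mathcomp Require Import all_boot all_order all_algebra.
From mathcomp Require Import finmap.
From mathcomp Require Import monalg.
From mathcomp Require Import boolp reals.
From mathcomp Require Import complex.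
From mathcomp Require Import ring zify.

Set Implicit Arguments.
Unset Strict Implicit.
Unset Printing Implicit Defensive.

Import Order.TTheory GRing.Theory Num.Theory.
Local Open Scope ring_scope.
Local Open Scope quotient_scope.

HB.mixin Record Lmodule_isLie (F : comNzRingType) L of GRing.Lmodule F L := {
  lie : L -> L -> L;
  lie_linearl : forall y, linear (fun x => lie x y);
  lie_linearr : forall x, linear (lie x);
  liexx : forall x, lie x x = 0;
  lie_jacobi : forall x y z,
    lie x (lie y z) + lie y (lie z x) + lie z (lie x y) = 0
}.

#[short(type="lieAlgType")]
HB.structure Definition LieAlgebra (F : comNzRingType) :=
  { L of GRing.Lmodule F L & Lmodule_isLie F L }.

Section LieTheory.
Variables (F : comNzRingType) (L : lieAlgType F).
Implicit Types x y z : L.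

Lemma lieDl x y z : lie (x + y) z = lie x z + lie y z.
Proof. by have := lie_linearl z 1 x y; rewrite !scale1r. Qed.
Lemma lieDr x y z : lie x (y + z) = lie x y + lie x z.
Proof. by have := lie_linearr x 1 y z; rewrite !scale1r. Qed.
Lemma lie0l x : lie 0 x = 0 :> L.
Proof. by apply: (@addrI _ (lie 0 x)); rewrite -lieDl !addr0. Qed.
Lemma lie0r x : lie x 0 = 0 :> L.
Proof. by apply: (@addrI _ (lie x 0)); rewrite -lieDr !addr0. Qed.
Lemma lieZl a x y : lie (a *: x) y = a *: lie x y.
Proof. by have := lie_linearl y a x 0; rewrite lie0l !addr0. Qed.
Lemma lieZr a x y : lie x (a *: y) = a *: lie x y.
Proof. by have := lie_linearr x a y 0; rewrite lie0r !addr0. Qed.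
Lemma lieC x y : lie y x = - lie x y.
Proof.
apply/eqP; rewrite -addr_eq0; apply/eqP.
by have := liexx (x + y); rewrite lieDl !lieDr !liexx add0r addr0 addrC.
Qed.
End LieTheory.

Lemma morph_commutator (A B : nzRingType) (e : A -> B) :
  {morph e : x y / x - y} -> {morph e : x y / x * y} ->
  forall u v z, e (u * v - v * u - z) = e u * e v - e v * e u - e z.
Proof. by move=> eB eM u v z; rewrite !eB !eM. Qed.

Inductive ideal_gen (A : nzRingType) (S : A -> Prop) : A -> Prop :=
| ideal_gen_in x of S x : ideal_gen S x
| ideal_gen0 : ideal_gen S 0
| ideal_genB x y of ideal_gen S x & ideal_gen S y : ideal_gen S (x - y)
| ideal_genMl a x of ideal_gen S x : ideal_gen S (a * x)
| ideal_genMr a x of ideal_gen S x : ideal_gen S (x * a).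

Inductive submod_gen (A : nzRingType) (V : lmodType A) (S : V -> Prop) :
    V -> Prop :=
| submod_gen_in x of S x : submod_gen S x
| submod_gen0 : submod_gen S 0
| submod_genB x y of submod_gen S x & submod_gen S y : submod_gen S (x - y)
| submod_genZ a x of submod_gen S x : submod_gen S (a *: x).

Section Envelope.
Variables (F : comNzRingType) (L : lieAlgType F).

(* Words in elements of L: the free algebra on the underlying set of L.
   The linearity relations below turn it into the tensor algebra T(L). *)
Definition env_words := {malg F[{fmonom L}]}.

HB.instance Definition _ := GRing.Lalgebra.on env_words.

Definition env_gen (x : L) : env_words := << 1 *g fmu x >>.

Inductive env_rel : env_words -> Prop :=
| env_rel_lin a x y :
    env_rel (env_gen (a *: x + y) - (a *: env_gen x + env_gen y))
| env_rel_lie x y :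
    env_rel (env_gen x * env_gen y - env_gen y * env_gen x
             - env_gen (lie x y)).

Definition env_ideal : {pred env_words} := fun w => `[< ideal_gen env_rel w >].

Lemma env_ideal_zmod_closed : zmod_closed env_ideal.
Proof.
split; first exact/asboolP/ideal_gen0.
by move=> x y /asboolP hx /asboolP hy; apply/asboolP/ideal_genB.
Qed.

HB.instance Definition _ :=
  GRing.isZmodClosed.Build env_words env_ideal env_ideal_zmod_closed.

Definition env := Quotient.quot env_ideal.

HB.instance Definition _ := GRing.Zmodule.on env.
HB.instance Definition _ := EqQuotient.on env.

Definition env_pi : env_words -> env := \pi_env.

Lemma env_piP x y : env_pi x = env_pi y <-> ideal_gen env_rel (x - y).
Proof.
split=> [h|h]; first by apply/asboolP; have/eqP := h; rewrite -Quotient.idealrBE.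
by apply/eqP; rewrite -Quotient.idealrBE; exact/asboolP.
Qed.

Lemma env_piK (u : env) : env_pi (repr u) = u.
Proof. exact: reprK. Qed.

Lemma env_piB : {morph env_pi : x y / x - y}.
Proof. by move=> x y; rewrite /env_pi !piE. Qed.
Lemma env_piD : {morph env_pi : x y / x + y}.
Proof. by move=> x y; rewrite /env_pi !piE. Qed.
Lemma env_pi0 : env_pi 0 = 0.
Proof. by rewrite -(subrr 0) env_piB subrr. Qed.

Definition env_one : env := env_pi 1.
Definition env_mul (u v : env) : env := env_pi (repr u * repr v).
Definition env_scale (a : F) (u : env) : env := env_pi (a *: repr u).

Lemma env_pi_repr x : ideal_gen env_rel (repr (env_pi x) - x).
Proof. by apply/env_piP; rewrite env_piK. Qed.

Lemma env_piM x y : env_pi (x * y) = env_mul (env_pi x) (env_pi y).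
Proof.
apply/esym/env_piP; set x' := repr _; set y' := repr _.
have -> : x' * y' - x * y = (x' - x) * y' - x * (y - y').
  by rewrite mulrBl mulrBr opprB addrA subrK.
apply: ideal_genB; first exact/ideal_genMr/env_pi_repr.
apply: ideal_genMl; rewrite -[y - y']opprB -sub0r.
by apply: ideal_genB; [exact: ideal_gen0 | exact: env_pi_repr].
Qed.

Lemma env_piZ a x : env_pi (a *: x) = env_scale a (env_pi x).
Proof.
apply/esym/env_piP; rewrite -scalerBr -[_ - x]mul1r scalerAl.
exact/ideal_genMl/env_pi_repr.
Qed.

Fact env_mulA : associative env_mul.
Proof.
move=> u v w; rewrite -[u]env_piK -[v]env_piK -[w]env_piK.
by rewrite -!env_piM mulrA.
Qed.
Fact env_mul1 : left_id env_one env_mul.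
Proof. by move=> u; rewrite -[u]env_piK -env_piM mul1r. Qed.
Fact env_mulr1 : right_id env_one env_mul.
Proof. by move=> u; rewrite -[u]env_piK -env_piM mulr1. Qed.
Fact env_mulDl : left_distributive env_mul +%R.
Proof.
move=> u v w; rewrite -[u]env_piK -[v]env_piK -[w]env_piK.
by rewrite -env_piD -!env_piM -env_piD mulrDl.
Qed.
Fact env_mulDr : right_distributive env_mul +%R.
Proof.
move=> u v w; rewrite -[u]env_piK -[v]env_piK -[w]env_piK.
by rewrite -env_piD -!env_piM -env_piD mulrDr.
Qed.

(* The constant term vanishes on the ideal, so 1 != 0 in the quotient. *)
Lemma env_ideal_mcoeff1 (w : env_words) :
  ideal_gen env_rel w -> w@_(mone : {fmonom L}) = 0 :> F.
Proof.
have gen0 x : (env_gen x)@_(mone : {fmonom L}) = 0 :> F.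
  by rewrite mcoeffU fm1_eq1.
pose e : {rmorphism env_words -> F} := mcoeff (mone : {fmonom L}).
rewrite -[_@__]/(e w).
have e0 x : e (env_gen x) = 0 by exact: gen0.
have eB : {morph e : x y / x - y} := rmorphB e.
have eM : {morph e : x y / x * y} := rmorphM e.
have eC u v z : e (u * v - v * u - z) = e u * e v - e v * e u - e z.
  exact: morph_commutator.
elim=> {w} [w []| |x y _ hx _ hy|a x _ hx|a x _ hx].
- move=> a x y; rewrite eB (rmorphD e) /= mcoeffZ !gen0.
  by rewrite mulr0 addr0 subrr.
- by move=> x y; rewrite eC !e0 !mul0r !subr0.
- exact: rmorph0.
- by rewrite eB hx hy subrr.
- by rewrite eM hx mulr0.
- by rewrite eM hx mul0r.
Qed.

Fact env_one_neq0 : env_one != 0.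
Proof.
apply/eqP; rewrite -env_pi0 => /env_piP; rewrite subr0 => /env_ideal_mcoeff1.
by rewrite mcoeff1 eqxx => /eqP; rewrite oner_eq0.
Qed.

HB.instance Definition _ := GRing.Zmodule_isNzRing.Build env
  env_mulA env_mul1 env_mulr1 env_mulDl env_mulDr env_one_neq0.

Fact env_scaleA a b u : env_scale a (env_scale b u) = env_scale (a * b) u.
Proof. by rewrite -[u]env_piK -!env_piZ scalerA. Qed.
Fact env_scale1 : left_id 1 env_scale.
Proof. by move=> u; rewrite -[u]env_piK -env_piZ scale1r. Qed.
Fact env_scaleDr : right_distributive env_scale +%R.
Proof.
move=> a u v; rewrite -[u]env_piK -[v]env_piK.
by rewrite -env_piD -!env_piZ -env_piD scalerDr.
Qed.
Fact env_scaleDl u : {morph env_scale^~ u : a b / a + b}.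
Proof. by move=> a b; rewrite -[u]env_piK -!env_piZ -env_piD scalerDl. Qed.

HB.instance Definition _ := GRing.Zmodule_isLmodule.Build F env
  env_scaleA env_scale1 env_scaleDr env_scaleDl.

Fact env_scaleAl (a : F) (u v : env) : a *: (u * v) = (a *: u) * v.
Proof.
rewrite -[u]env_piK -[v]env_piK; rewrite /GRing.scale /GRing.mul /=.
by rewrite -!(env_piM, env_piZ) scalerAl.
Qed.

HB.instance Definition _ := GRing.Lmodule_isLalgebra.Build F env env_scaleAl.

Lemma env_words_scaleAr (a : F) (x y : env_words) :
  a *: (x * y) = x * (a *: y).
Proof.
have ac (b : F) (z : env_words) : GRing.comm z (b%:MP).
  rewrite /GRing.comm mul_malgC [z]monalgE mulr_suml scaler_sumr.
  apply: eq_bigr => k _; rewrite malgM_def fgmulUU mulm1.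
  by apply/malgP => k'; rewrite mcoeffZ mcoeffU mcoeffU mulrnAr mulrC.
by rewrite -!mul_malgC mulrA -ac mulrA.
Qed.

Fact env_scaleAr (a : F) (u v : env) : a *: (u * v) = u * (a *: v).
Proof.
rewrite -[u]env_piK -[v]env_piK; rewrite /GRing.scale /GRing.mul /=.
by rewrite -!(env_piM, env_piZ) env_words_scaleAr.
Qed.

HB.instance Definition _ := GRing.Lalgebra_isAlgebra.Build F env env_scaleAr.

Definition env_in (x : L) : env := env_pi (env_gen x).

Lemma env_in_linear : linear env_in.
Proof.
move=> a x y; rewrite /env_in.
have -> : a *: env_pi (env_gen x) = env_pi (a *: env_gen x).
  by rewrite env_piZ.
by rewrite -env_piD; apply/env_piP/ideal_gen_in/env_rel_lin.
Qed.

HB.instance Definition _ := GRing.isLinear.Build F L env _ env_in env_in_linear.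

Lemma env_in_lie x y :
  env_in (lie x y) = env_in x * env_in y - env_in y * env_in x.
Proof.
have mE (u v : env_words) : env_pi u * env_pi v = env_pi (u * v).
  by rewrite env_piM.
rewrite /env_in !mE -env_piB; apply/esym/env_piP/ideal_gen_in/env_rel_lie.
Qed.

(* The universal property: a linear map f from L to an algebra sending
   brackets to commutators extends to env. *)
Section Lift.
Variables (A : algType F) (f : L -> A).

Definition env_lift_word (m : {fmonom L}) : A := \prod_(x <- m) f x.
Definition env_lift (u : env) : A := mmap (in_alg A) env_lift_word (repr u).

Definition lie_to_assoc :=
  linear f /\ forall x y, f (lie x y) = f x * f y - f y * f x.

Fact env_lift_word_mmorphism : mmorphism env_lift_word.
Proof.
rewrite /env_lift_word; split; last by rewrite fm1 big_nil.
by move=> m m'; rewrite fmM big_cat.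
Qed.

HB.instance Definition _ :=
  isMultiplicative.Build {fmonom L} A env_lift_word env_lift_word_mmorphism.

Local Notation ev := (mmap (in_alg A) env_lift_word : env_words -> A).

Lemma env_lift_evM : {morph ev : x y / x * y}.
Proof.
have [] // := @commr_mmap_is_multiplicative _ _ _ (in_alg A) env_lift_word.
by move=> g m m'; rewrite /GRing.comm /= mulr_algl mulr_algr.
Qed.

Lemma env_lift_evZ a x : ev (a *: x) = a *: ev x.
Proof. by rewrite mmapZ /= mulr_algl. Qed.

Lemma env_lift_ev_gen x : ev (env_gen x) = f x.
Proof. by rewrite mmapU /= mulr_algl scale1r /env_lift_word fmU big_seq1. Qed.

Hypothesis fP : lie_to_assoc.

Lemma env_lift_ev_ideal w : ideal_gen env_rel w -> ev w = 0.
Proof.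
have [flin flie] := fP.
have evB : {morph ev : x y / x - y} := raddfB ev.
have evD : {morph ev : x y / x + y} := raddfD ev.
have evC u v z : ev (u * v - v * u - z) = ev u * ev v - ev v * ev u - ev z.
  exact: (morph_commutator evB env_lift_evM).
elim=> {w} [w []| |x y _ hx _ hy|a x _ hx|a x _ hx].
- move=> a x y; rewrite evB evD env_lift_evZ !env_lift_ev_gen.
  by rewrite flin subrr.
- move=> x y; rewrite evC !env_lift_ev_gen.
  by rewrite flie subrr.
- exact: raddf0.
- by rewrite evB hx hy subrr.
- by rewrite env_lift_evM hx mulr0.
- by rewrite env_lift_evM hx mul0r.
Qed.

Lemma env_lift_pi w : env_lift (env_pi w) = ev w.
Proof.
apply/eqP; rewrite -subr_eq0 -raddfB /=; apply/eqP.
exact/env_lift_ev_ideal/env_pi_repr.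
Qed.

Lemma env_lift_in x : env_lift (env_in x) = f x.
Proof. by rewrite env_lift_pi env_lift_ev_gen. Qed.

Lemma env_lift_zmod_morphism : zmod_morphism env_lift.
Proof.
move=> u v; rewrite -[u]env_piK -[v]env_piK -env_piB !env_lift_pi.
exact: raddfB.
Qed.

Lemma env_lift_monoid_morphism : monoid_morphism env_lift.
Proof.
split; first by rewrite -[1]/(env_pi 1) env_lift_pi mmap1.
move=> u v; rewrite -[u]env_piK -[v]env_piK -[_ * _]/(env_mul _ _) -env_piM.
by rewrite !env_lift_pi env_lift_evM.
Qed.

Lemma env_lift_scalable : scalable env_lift.
Proof.
move=> a u; rewrite -[u]env_piK -[_ *: _]/(env_scale _ _) -env_piZ.
by rewrite !env_lift_pi env_lift_evZ.
Qed.
End Lift.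
End Envelope.

(* B (x)_A V for a ring morphism phi : A -> B, where B is a right A-module
   through phi, as a left B-module. An element of {malg B[V]} is a formal sum
   of symbols << b *g v >>, additive in b, standing for b (x) v. *)
Section Tensor.
Variables (A B : nzRingType) (phi : {rmorphism A -> B}) (V : lmodType A).

Definition tens_free := {malg B[V]}.
HB.instance Definition _ := GRing.Lmodule.on tens_free.

Definition tens_sym (b : B) (v : V) : tens_free := << b *g v >>.

Inductive tens_rel : tens_free -> Prop :=
| tens_rel_add b v w :
    tens_rel (tens_sym b (v + w) - (tens_sym b v + tens_sym b w))
| tens_rel_bal b a v :
    tens_rel (tens_sym (b * phi a) v - tens_sym b (a *: v)).

Definition tens_sub : {pred tens_free} := fun w => `[< submod_gen tens_rel w >].

Lemma tens_sub_zmod_closed : zmod_closed tens_sub.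
Proof.
split; first exact/asboolP/submod_gen0.
by move=> x y /asboolP hx /asboolP hy; apply/asboolP/submod_genB.
Qed.

HB.instance Definition _ :=
  GRing.isZmodClosed.Build tens_free tens_sub tens_sub_zmod_closed.

Definition tensor := Quotient.quot tens_sub.

HB.instance Definition _ := GRing.Zmodule.on tensor.
HB.instance Definition _ := EqQuotient.on tensor.

Definition tens_pi : tens_free -> tensor := \pi_tensor.

Lemma tens_piP x y : tens_pi x = tens_pi y <-> submod_gen tens_rel (x - y).
Proof.
split=> [h|h]; first by apply/asboolP; have/eqP := h; rewrite -Quotient.idealrBE.
by apply/eqP; rewrite -Quotient.idealrBE; exact/asboolP.
Qed.

Lemma tens_piK (u : tensor) : tens_pi (repr u) = u.
Proof. exact: reprK. Qed.

Lemma tens_piB : {morph tens_pi : x y / x - y}.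
Proof. by move=> x y; rewrite /tens_pi !piE. Qed.
Lemma tens_piD : {morph tens_pi : x y / x + y}.
Proof. by move=> x y; rewrite /tens_pi !piE. Qed.

Definition tens_scale (b : B) (u : tensor) : tensor := tens_pi (b *: repr u).

Lemma tens_piZ b x : tens_pi (b *: x) = tens_scale b (tens_pi x).
Proof.
apply/esym/tens_piP; rewrite -scalerBr; apply/submod_genZ.
by apply/tens_piP; rewrite tens_piK.
Qed.

Fact tens_scaleA a b u : tens_scale a (tens_scale b u) = tens_scale (a * b) u.
Proof. by rewrite -[u]tens_piK -!tens_piZ scalerA. Qed.
Fact tens_scale1 : left_id 1 tens_scale.
Proof. by move=> u; rewrite -[u]tens_piK -tens_piZ scale1r. Qed.
Fact tens_scaleDr : right_distributive tens_scale +%R.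
Proof.
move=> a u v; rewrite -[u]tens_piK -[v]tens_piK.
by rewrite -tens_piD -!tens_piZ -tens_piD scalerDr.
Qed.
Fact tens_scaleDl u : {morph tens_scale^~ u : a b / a + b}.
Proof. by move=> a b; rewrite -[u]tens_piK -!tens_piZ -tens_piD scalerDl. Qed.

HB.instance Definition _ := GRing.Zmodule_isLmodule.Build B tensor
  tens_scaleA tens_scale1 tens_scaleDr tens_scaleDl.

Definition tens (b : B) (v : V) : tensor := tens_pi (tens_sym b v).
End Tensor.

Section TypeD.
Variables (F : fieldType) (l : nat).

Definition soJ : 'M[F]_(l + l) := block_mx 0 1%:M 1%:M 0.

Definition so_pred : {pred 'M[F]_(l + l)} :=
  fun X => X^T *m soJ + soJ *m X == 0.

Lemma so_pred_submod_closed : submod_closed so_pred.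
Proof.
split; first by rewrite unfold_in trmx0 mul0mx mulmx0 addr0.
move=> a X Y; rewrite !unfold_in => /eqP hX /eqP hY; apply/eqP.
rewrite linearP /= mulmxDl mulmxDr -scalemxAl -scalemxAr addrACA -scalerDr.
by rewrite hX hY scaler0 addr0.
Qed.

HB.instance Definition _ :=
  GRing.isSubmodClosed.Build F 'M[F]_(l + l) so_pred so_pred_submod_closed.

Record so := So { so_val :> 'M[F]_(l + l); so_valP : so_val \in so_pred }.

HB.instance Definition _ := [isSub for so_val].
HB.instance Definition _ := [Choice of so by <:].
HB.instance Definition _ := [SubChoice_isSubLmodule of so by <:].

Lemma so_eqP (X : 'M[F]_(l + l)) :
  X \in so_pred -> X^T *m soJ = - (soJ *m X).
Proof. by rewrite unfold_in addr_eq0 => /eqP. Qed.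

Fact so_lie_subproof (X Y : so) :
  so_val X *m so_val Y - so_val Y *m so_val X \in so_pred.
Proof.
have [hX hY] := (so_eqP (so_valP X), so_eqP (so_valP Y)).
rewrite unfold_in linearB /= !trmx_mul mulmxBl mulmxBr -!mulmxA hX hY.
by rewrite !mulmxN !mulmxA hX hY !mulNmx !opprK addrC subrKA subrr.
Qed.

Definition so_lie (X Y : so) : so := So (so_lie_subproof X Y).

Fact so_lie_linearl Y : linear (fun X => so_lie X Y).
Proof.
move=> a X X'; apply: val_inj; rewrite linearP /=.
rewrite mulmxDl mulmxDr -scalemxAl -scalemxAr scalerBr.
by rewrite opprD addrACA.
Qed.

Fact so_lie_linearr X : linear (so_lie X).
Proof.
move=> a Y Y'; apply: val_inj; rewrite linearP /=.
rewrite mulmxDl mulmxDr -scalemxAl -scalemxAr scalerBr.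
by rewrite opprD addrACA.
Qed.

Fact so_liexx X : so_lie X X = 0.
Proof. by apply: val_inj; rewrite /= subrr. Qed.

Fact so_lie_jacobi X Y Z :
  so_lie X (so_lie Y Z) + so_lie Y (so_lie Z X) + so_lie Z (so_lie X Y) = 0.
Proof.
apply: val_inj; rewrite /= !(mulmxBl, mulmxBr) !mulmxA.
set a := _ *m _ *m _; set b := _ *m _ *m _; set c := _ *m _ *m _.
set d := _ *m _ *m _; set e := _ *m _ *m _; set f := _ *m _ *m _.
rewrite !opprB.
apply/matrixP => i j; rewrite !mxE; ring.
Qed.

HB.instance Definition _ := Lmodule_isLie.Build F so
  so_lie_linearl so_lie_linearr so_liexx so_lie_jacobi.
End TypeD.

(* Biadditive extension from the monomials << x *g m >> = x (x) t^m. *)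
Section MalgBiadditive.
Variables (K : choiceType) (V T : zmodType) (B : K -> K -> V -> V -> T).
Hypothesis BDl : forall m r x x' y, B m r (x + x') y = B m r x y + B m r x' y.
Hypothesis BDr : forall m r x y y', B m r x (y + y') = B m r x y + B m r x y'.
Implicit Types p q : {malg V[K]}.

Definition malg_bi p q : T :=
  \sum_(m <- msupp p) \sum_(r <- msupp q) B m r p@_m q@_r.

Let B0l m r y : B m r 0 y = 0.
Proof. by apply: (@addrI _ (B m r 0 y)); rewrite -BDl !addr0. Qed.
Let B0r m r x : B m r x 0 = 0.
Proof. by apply: (@addrI _ (B m r x 0)); rewrite -BDr !addr0. Qed.

Lemma malg_biw (d e : {fset K}) p q :
    (msupp p `<=` d)%fset -> (msupp q `<=` e)%fset ->
  malg_bi p q = \sum_(m <- d) \sum_(r <- e) B m r p@_m q@_r.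
Proof.
move=> hd he; rewrite /malg_bi (big_fset_incl _ hd) /=.
  apply: eq_bigr => m _; apply: (big_fset_incl _ he) => r _ /mcoeff_outdom ->.
  exact: B0r.
by move=> m _ /mcoeff_outdom ->; apply: big1 => r _; exact: B0l.
Qed.

Lemma malg_biDl p p' q : malg_bi (p + p') q = malg_bi p q + malg_bi p' q.
Proof.
pose d := (msupp p `|` msupp p')%fset; pose e := msupp q.
rewrite (@malg_biw d e) ?msuppD_le // (@malg_biw d e p) ?fsubsetUl //.
rewrite (@malg_biw d e p') ?fsubsetUr // -big_split; apply: eq_bigr => m _ /=.
by rewrite -big_split; apply: eq_bigr => r _ /=; rewrite mcoeffD BDl.
Qed.

Lemma malg_biDr p q q' : malg_bi p (q + q') = malg_bi p q + malg_bi p q'.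
Proof.
pose d := msupp p; pose e := (msupp q `|` msupp q')%fset.
rewrite (@malg_biw d e) ?msuppD_le // (@malg_biw d e p q) ?fsubsetUl //.
rewrite (@malg_biw d e p q') ?fsubsetUr // -big_split; apply: eq_bigr => m _ /=.
by rewrite -big_split; apply: eq_bigr => r _ /=; rewrite mcoeffD BDr.
Qed.

Lemma malg_bi0l q : malg_bi 0 q = 0.
Proof. by rewrite /malg_bi msupp0 big_seq_fset0. Qed.

Lemma malg_bi0r p : malg_bi p 0 = 0.
Proof. by rewrite /malg_bi msupp0 big1 // => m _; rewrite big_seq_fset0. Qed.

Lemma malg_biU x m y r : malg_bi << x *g m >> << y *g r >> = B m r x y.
Proof.
rewrite (@malg_biw [fset m] [fset r])%fset ?msuppU_le //.
by rewrite !big_seq_fset1 !mcoeffUU.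
Qed.
End MalgBiadditive.

Lemma malg_ind (K : choiceType) (V : zmodType) (P : {malg V[K]} -> Prop) :
    P 0 -> (forall p q, P p -> P q -> P (p + q)) ->
    (forall x m, P << x *g m >>) -> forall p, P p.
Proof.
move=> P0 PD PU p; rewrite [p]monalgE.
by elim/big_ind: _ => // m _; exact: PU.
Qed.

Section Affine.
Variables (F : fieldType) (l : nat).
Local Notation g := (so F l).

Definition so_form (X Y : g) : F := 2^-1 * \tr (so_val X *m so_val Y).

Lemma so_formDl X X' Y : so_form (X + X') Y = so_form X Y + so_form X' Y.
Proof. by rewrite /so_form /= mulmxDl linearD mulrDr. Qed.
Lemma so_formDr X Y Y' : so_form X (Y + Y') = so_form X Y + so_form X Y'.
Proof. by rewrite /so_form /= mulmxDr linearD mulrDr. Qed.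
Lemma so_formZl a X Y : so_form (a *: X) Y = a * so_form X Y.
Proof. by rewrite /so_form /= -scalemxAl linearZ /= mulrCA. Qed.
Lemma so_formZr a X Y : so_form X (a *: Y) = a * so_form X Y.
Proof. by rewrite /so_form /= -scalemxAr linearZ /= mulrCA. Qed.
Lemma so_formC X Y : so_form X Y = so_form Y X.
Proof. by rewrite /so_form mxtrace_mulC. Qed.
Lemma so_form_inv X Y Z : so_form (lie X Y) Z = so_form X (lie Y Z).
Proof.
rewrite /so_form /=; congr (_ * _); rewrite mulmxBl mulmxBr !linearB /=.
by congr (_ - _); rewrite -?mulmxA // [LHS]mxtrace_mulC -!mulmxA.
Qed.

(* The pair (p, c) stands for p + c K; << x *g m >> in {malg g[int]} is
   x (x) t^m. *)
Definition affine := ({malg g[int]} * F)%type.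

HB.instance Definition _ := GRing.Zmodule.on affine.

Definition loop_scale (a : F) (p : {malg g[int]}) : {malg g[int]} :=
  \sum_(m <- msupp p) << a *: p@_m *g m >>.

Definition affine_scale (a : F) (u : affine) : affine :=
  (loop_scale a u.1, a * u.2).

Lemma loop_scaleE a p m : (loop_scale a p)@_m = a *: p@_m.
Proof.
rewrite {2}[p]monalgE /loop_scale !raddf_sum /=.
by apply: eq_bigr => r _; rewrite !mcoeffU scalerMnr.
Qed.

Fact affine_scaleA a b u :
  affine_scale a (affine_scale b u) = affine_scale (a * b) u.
Proof.
by congr (_, _); rewrite ?mulrA //; apply/malgP => m; rewrite !loop_scaleE scalerA.
Qed.
Fact affine_scale1 : left_id 1 affine_scale.
Proof.
move=> [p c]; congr (_, _); rewrite ?mul1r //.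
by apply/malgP => m; rewrite loop_scaleE scale1r.
Qed.
Fact affine_scaleDr : right_distributive affine_scale +%R.
Proof.
move=> a [p c] [q d]; congr (_, _); rewrite ?mulrDr //.
by apply/malgP => m; rewrite !(mcoeffD, loop_scaleE) scalerDr.
Qed.
Fact affine_scaleDl u : {morph affine_scale^~ u : a b / a + b}.
Proof.
move=> a b; congr (_, _); rewrite ?mulrDl //.
by apply/malgP => m; rewrite !(mcoeffD, loop_scaleE) scalerDl.
Qed.

HB.instance Definition _ := GRing.Zmodule_isLmodule.Build F affine
  affine_scaleA affine_scale1 affine_scaleDr affine_scaleDl.

Definition loop_lie (p q : {malg g[int]}) : {malg g[int]} :=
  \sum_(m <- msupp p) \sum_(r <- msupp q) << lie p@_m q@_r *g m + r >>.

Definition loop_cocycle (p q : {malg g[int]}) : F :=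
  \sum_(m <- msupp p) \sum_(r <- msupp q)
    m%:~R * (m + r == 0)%:R * so_form p@_m q@_r.

Definition affine_lie (u v : affine) : affine :=
  (loop_lie u.1 v.1, loop_cocycle u.1 v.1).

Let lieB (m r : int) (x y : g) : {malg g[int]} := << lie x y *g m + r >>.
Let cocB (m r : int) (x y : g) : F := m%:~R * (m + r == 0)%:R * so_form x y.

Let lieBDl m r x x' y : lieB m r (x + x') y = lieB m r x y + lieB m r x' y.
Proof. by rewrite /lieB lieDl monalgUD. Qed.
Let lieBDr m r x y y' : lieB m r x (y + y') = lieB m r x y + lieB m r x y'.
Proof. by rewrite /lieB lieDr monalgUD. Qed.
Let cocBDl m r x x' y : cocB m r (x + x') y = cocB m r x y + cocB m r x' y.
Proof. by rewrite /cocB so_formDl mulrDr. Qed.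
Let cocBDr m r x y y' : cocB m r x (y + y') = cocB m r x y + cocB m r x y'.
Proof. by rewrite /cocB so_formDr mulrDr. Qed.

Lemma loop_lieDl p p' q : loop_lie (p + p') q = loop_lie p q + loop_lie p' q.
Proof. exact: (malg_biDl lieBDl lieBDr). Qed.
Lemma loop_lieDr p q q' : loop_lie p (q + q') = loop_lie p q + loop_lie p q'.
Proof. exact: (malg_biDr lieBDl lieBDr). Qed.
Lemma loop_lieU x m y r :
  loop_lie << x *g m >> << y *g r >> = << lie x y *g m + r >>.
Proof. exact: (malg_biU lieBDl lieBDr). Qed.
Lemma loop_lie0l q : loop_lie 0 q = 0.
Proof. exact: (malg_bi0l lieB). Qed.
Lemma loop_lie0r p : loop_lie p 0 = 0.
Proof. exact: (malg_bi0r lieB). Qed.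

Lemma loop_cocycleDl p p' q :
  loop_cocycle (p + p') q = loop_cocycle p q + loop_cocycle p' q.
Proof. exact: (malg_biDl cocBDl cocBDr). Qed.
Lemma loop_cocycleDr p q q' :
  loop_cocycle p (q + q') = loop_cocycle p q + loop_cocycle p q'.
Proof. exact: (malg_biDr cocBDl cocBDr). Qed.
Lemma loop_cocycleU x m y r :
  loop_cocycle << x *g m >> << y *g r >> =
    m%:~R * (m + r == 0)%:R * so_form x y.
Proof. exact: (malg_biU cocBDl cocBDr). Qed.
Lemma loop_cocycle0l q : loop_cocycle 0 q = 0.
Proof. exact: (malg_bi0l cocB). Qed.
Lemma loop_cocycle0r p : loop_cocycle p 0 = 0.
Proof. exact: (malg_bi0r cocB). Qed.

#[local] Opaque loop_lie loop_cocycle.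

Lemma loop_scaleD a p q : loop_scale a (p + q) = loop_scale a p + loop_scale a q.
Proof. by apply/malgP => m; rewrite !(mcoeffD, loop_scaleE) scalerDr. Qed.
Lemma loop_scale0 a : loop_scale a 0 = 0.
Proof. by apply/malgP => m; rewrite loop_scaleE !mcoeff0 scaler0. Qed.
Lemma loop_scaleU a x m : loop_scale a << x *g m >> = << a *: x *g m >>.
Proof. by apply/malgP => r; rewrite loop_scaleE !mcoeffU scalerMnr. Qed.

Lemma loop_lieZl a p q : loop_lie (loop_scale a p) q = loop_scale a (loop_lie p q).
Proof.
elim/malg_ind: p => [|p p' hp hp'|x m].
- by rewrite loop_scale0 loop_lie0l loop_scale0.
- by rewrite loop_scaleD !loop_lieDl hp hp' loop_scaleD.
elim/malg_ind: q => [|q q' hq hq'|y r].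
- by rewrite !loop_lie0r loop_scale0.
- by rewrite !loop_lieDr hq hq' loop_scaleD.
by rewrite loop_scaleU !loop_lieU loop_scaleU lieZl.
Qed.

Lemma loop_lieC p q : loop_lie q p = - loop_lie p q.
Proof.
elim/malg_ind: p => [|p p' hp hp'|x m].
- by rewrite loop_lie0l loop_lie0r oppr0.
- by rewrite loop_lieDl loop_lieDr hp hp' opprD.
elim/malg_ind: q => [|q q' hq hq'|y r].
- by rewrite loop_lie0l loop_lie0r oppr0.
- by rewrite loop_lieDl loop_lieDr hq hq' opprD.
by rewrite !loop_lieU addrC lieC monalgUN.
Qed.

Lemma loop_lieUU x m : loop_lie << x *g m >> << x *g m >> = 0.
Proof. by rewrite loop_lieU liexx monalgU0. Qed.

Lemma loop_liexx p : loop_lie p p = 0.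
Proof.
elim/malg_ind: p => [|p q hp hq|x m]; first exact: loop_lie0l.
  by rewrite loop_lieDl !loop_lieDr hp hq add0r addr0 [X in _ + X]loop_lieC subrr.
exact: loop_lieUU.
Qed.

Lemma loop_cocycleZl a p q : loop_cocycle (loop_scale a p) q = a * loop_cocycle p q.
Proof.
elim/malg_ind: p => [|p p' hp hp'|x m].
- by rewrite loop_scale0 loop_cocycle0l mulr0.
- by rewrite loop_scaleD !loop_cocycleDl hp hp' mulrDr.
elim/malg_ind: q => [|q q' hq hq'|y r].
- by rewrite !loop_cocycle0r mulr0.
- by rewrite !loop_cocycleDr hq hq' mulrDr.
by rewrite loop_scaleU !loop_cocycleU so_formZl mulrCA.
Qed.

Lemma loop_cocycleC p q : loop_cocycle q p = - loop_cocycle p q.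
Proof.
elim/malg_ind: p => [|p p' hp hp'|x m].
- by rewrite loop_cocycle0l loop_cocycle0r oppr0.
- by rewrite loop_cocycleDl loop_cocycleDr hp hp' opprD.
elim/malg_ind: q => [|q q' hq hq'|y r].
- by rewrite loop_cocycle0l loop_cocycle0r oppr0.
- by rewrite loop_cocycleDl loop_cocycleDr hq hq' opprD.
rewrite !loop_cocycleU so_formC [r + m]addrC.
case: eqP => [/eqP|_]; last by rewrite !mulr0 !mul0r oppr0.
by rewrite addr_eq0 => /eqP ->; rewrite intrN !mulNr opprK.
Qed.

Lemma loop_cocyclexx p : loop_cocycle p p = 0.
Proof.
elim/malg_ind: p => [|p q hp hq|x m]; first exact: loop_cocycle0l.
  rewrite loop_cocycleDl !loop_cocycleDr hp hq add0r addr0.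
  by rewrite [X in _ + X]loop_cocycleC subrr.
rewrite loop_cocycleU; case: eqP => [h|_]; last by rewrite mulr0 mul0r.
suff -> : m = 0 by rewrite !mul0r.
by move: h; lia.
Qed.

Fact affine_lie_linearl v : linear (fun u => affine_lie u v).
Proof.
move=> a [p c] [q d]; rewrite /affine_lie /=; congr (_, _).
  by rewrite loop_lieDl loop_lieZl.
by rewrite loop_cocycleDl loop_cocycleZl.
Qed.

Lemma affine_lieC u v : affine_lie v u = - affine_lie u v.
Proof. by rewrite /affine_lie loop_lieC loop_cocycleC. Qed.

Fact affine_lie_linearr u : linear (affine_lie u).
Proof.
move=> a v w; rewrite affine_lieC affine_lie_linearl [affine_lie u v]affine_lieC.
by rewrite [affine_lie u w]affine_lieC opprD scalerN.
Qed.

Fact affine_liexx u : affine_lie u u = 0.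
Proof. by rewrite /affine_lie loop_liexx loop_cocyclexx. Qed.

Let add3 (T : zmodType) (x x' y y' z z' : T) :
  (x + x') + (y + y') + (z + z') = (x + y + z) + (x' + y' + z').
Proof. by rewrite [x + x' + _]addrACA (addrACA (x + y)). Qed.

Let add00 (T : zmodType) (x y : T) : x = 0 -> y = 0 -> x + y = 0.
Proof. by move=> -> ->; rewrite addr0. Qed.

Lemma loop_lie_jacobi p q s :
  loop_lie p (loop_lie q s) + loop_lie q (loop_lie s p)
    + loop_lie s (loop_lie p q) = 0.
Proof.
elim/malg_ind: p => [|p p' hp hp'|x m].
- by rewrite !(loop_lie0l, loop_lie0r) !addr0.
- by rewrite !(loop_lieDl, loop_lieDr) add3 (add00 hp hp').
elim/malg_ind: q => [|q q' hq hq'|y r].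
- by rewrite !(loop_lie0l, loop_lie0r) !addr0.
- by rewrite !(loop_lieDl, loop_lieDr) add3 (add00 hq hq').
elim/malg_ind: s => [|s s' hs hs'|z n].
- by rewrite !(loop_lie0l, loop_lie0r) !addr0.
- by rewrite !(loop_lieDl, loop_lieDr) add3 (add00 hs hs').
rewrite !loop_lieU (_ : r + (n + m) = m + (r + n)); last by ring.
rewrite (_ : n + (m + r) = m + (r + n)); last by ring.
by rewrite -!monalgUD lie_jacobi monalgU0.
Qed.

Lemma loop_cocycle_jacobi p q s :
  loop_cocycle p (loop_lie q s) + loop_cocycle q (loop_lie s p)
    + loop_cocycle s (loop_lie p q) = 0.
Proof.
elim/malg_ind: p => [|p p' hp hp'|x m].
- by rewrite !(loop_lie0l, loop_lie0r, loop_cocycle0l, loop_cocycle0r) !addr0.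
- rewrite !(loop_lieDl, loop_lieDr, loop_cocycleDl, loop_cocycleDr).
  by rewrite add3 (add00 hp hp').
elim/malg_ind: q => [|q q' hq hq'|y r].
- by rewrite !(loop_lie0l, loop_lie0r, loop_cocycle0l, loop_cocycle0r) !addr0.
- rewrite !(loop_lieDl, loop_lieDr, loop_cocycleDl, loop_cocycleDr).
  by rewrite add3 (add00 hq hq').
elim/malg_ind: s => [|s s' hs hs'|z n].
- by rewrite !(loop_lie0l, loop_lie0r, loop_cocycle0l, loop_cocycle0r) !addr0.
- rewrite !(loop_lieDl, loop_lieDr, loop_cocycleDl, loop_cocycleDr).
  by rewrite add3 (add00 hs hs').
rewrite !loop_lieU !loop_cocycleU.
rewrite (_ : r + (n + m) = m + (r + n)); last by ring.
rewrite (_ : n + (m + r) = m + (r + n)); last by ring.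
have [h|_] := eqVneq (m + (r + n)) 0; last by rewrite !mulr0 !mul0r !addr0.
rewrite !mulr1 -[so_form y _]so_form_inv [so_form (lie y z) x]so_formC.
rewrite [so_form z _]so_formC so_form_inv -!mulrDl -!intrD.
by rewrite -addrA h mul0r.
Qed.

Fact affine_lie_jacobi u v w :
  affine_lie u (affine_lie v w) + affine_lie v (affine_lie w u)
    + affine_lie w (affine_lie u v) = 0.
Proof.
by congr (_, _); [exact: loop_lie_jacobi | exact: loop_cocycle_jacobi].
Qed.

HB.instance Definition _ := Lmodule_isLie.Build F affine
  affine_lie_linearl affine_lie_linearr affine_liexx affine_lie_jacobi.

Definition mode (x : g) (m : int) : affine := (<< x *g m >>, 0).
Definition central : affine := (0, 1).
End Affine.

Section Vacuum.
Variables (F : fieldType) (l : nat).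
Local Notation g := (so F l).
Local Notation ghat := (affine F l).

(* g (x) C[t] + C K *)
Definition nonneg_pred : {pred ghat} :=
  fun u => all (fun m : int => 0 <= m) (msupp u.1).

Lemma nonnegP (u : ghat) :
  reflect (forall m : int, m < 0 -> u.1@_m = 0) (u \in nonneg_pred).
Proof.
apply: (iffP allP) => h m => [hm | hu].
  by apply: mcoeff_outdom; apply/negP => /h; rewrite leNgt hm.
rewrite leNgt; apply/negP => /h /eqP.
by rewrite mcoeff_eq0 hu.
Qed.

Lemma nonneg_submod_closed : submod_closed nonneg_pred.
Proof.
split; first by apply/nonnegP => m _; rewrite mcoeff0.
move=> a u v /nonnegP hu /nonnegP hv; apply/nonnegP => m hm.
by rewrite /= mcoeffD loop_scaleE hu // hv // scaler0 addr0.
Qed.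

HB.instance Definition _ :=
  GRing.isSubmodClosed.Build F ghat nonneg_pred nonneg_submod_closed.

Record nonneg := Nonneg { nonneg_val :> ghat; _ : nonneg_val \in nonneg_pred }.

HB.instance Definition _ := [isSub for nonneg_val].
HB.instance Definition _ := [Choice of nonneg by <:].
HB.instance Definition _ := [SubChoice_isSubLmodule of nonneg by <:].

Fact nonneg_lie_subproof (u v : nonneg) :
  lie (nonneg_val u) (nonneg_val v) \in nonneg_pred.
Proof.
case: u v => [u hu] [v hv]; apply/nonnegP => m hm /=.
have hu0 := allP hu; have hv0 := allP hv.
rewrite /loop_lie raddf_sum big_seq big1 //= => r /hu0 hr.
rewrite raddf_sum big_seq big1 //= => s /hv0 hs.
rewrite mcoeffU; case: eqP => // h; exfalso.
by move: hm; rewrite -h ltNge addr_ge0.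
Qed.

Definition nonneg_lie (u v : nonneg) : nonneg := Nonneg (nonneg_lie_subproof u v).

Fact nonneg_lie_linearl v : linear (fun u => nonneg_lie u v).
Proof.
move=> a u u'; apply: val_inj; exact: (lie_linearl (nonneg_val v)).
Qed.
Fact nonneg_lie_linearr u : linear (nonneg_lie u).
Proof.
move=> a v v'; apply: val_inj; exact: (lie_linearr (nonneg_val u)).
Qed.
Fact nonneg_liexx u : nonneg_lie u u = 0.
Proof. by apply: val_inj; rewrite /= liexx. Qed.
Fact nonneg_lie_jacobi u v w :
  nonneg_lie u (nonneg_lie v w) + nonneg_lie v (nonneg_lie w u)
    + nonneg_lie w (nonneg_lie u v) = 0.
Proof. by apply: val_inj; rewrite !linearD /= lie_jacobi. Qed.

HB.instance Definition _ := Lmodule_isLie.Build F nonneg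
  nonneg_lie_linearl nonneg_lie_linearr nonneg_liexx nonneg_lie_jacobi.

(* U(g (x) C[t] + C K) -> U(ghat) *)
Definition nonneg_env : env nonneg -> env ghat :=
  env_lift (fun u : nonneg => env_in (nonneg_val u)).

Fact nonneg_env_lie : lie_to_assoc (fun u : nonneg => env_in (nonneg_val u)).
Proof.
split=> [a u v|u v]; first exact: (env_in_linear a (nonneg_val u)).
exact: env_in_lie.
Qed.

HB.instance Definition _ := GRing.isZmodMorphism.Build _ _ nonneg_env
  (env_lift_zmod_morphism nonneg_env_lie).
HB.instance Definition _ := GRing.isMonoidMorphism.Build _ _ nonneg_env
  (env_lift_monoid_morphism nonneg_env_lie).

(* The one-dimensional module: g (x) C[t] acts by 0 and K by k. *)
Definition level_char (k : F) (u : nonneg) : F^o := k * (nonneg_val u).2.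

Fact loop_cocycle_nonneg (u v : nonneg) :
  loop_cocycle (nonneg_val u).1 (nonneg_val v).1 = 0.
Proof.
case: u v => [u hu] [v hv] /=.
have hu0 := allP hu; have hv0 := allP hv.
rewrite /loop_cocycle big_seq big1 //= => r /hu0 hr.
rewrite big_seq big1 //= => s /hv0 hs.
case: eqP => [h|_]; last by rewrite mulr0 mul0r.
suff -> : r = 0 by rewrite !mul0r.
by move: hr hs h; lia.
Qed.

Fact level_char_lie k : lie_to_assoc (level_char k).
Proof.
split=> [a u v|u v]; rewrite /level_char.
  by rewrite /= mulrDr mulrCA.
by rewrite /= loop_cocycle_nonneg mulr0 [_ * (k * (nonneg_val u).2)]mulrC subrr.
Qed.

Definition level_mod (k : F) : Type := F.

Section LevelMod.
Variable k : F.

HB.instance Definition _ := GRing.Zmodule.copy (level_mod k) F.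

Definition level_scale (u : env nonneg) (c : level_mod k) : level_mod k :=
  (env_lift (level_char k) u : F) * c.

Let chi_M u v : env_lift (level_char k) (u * v) =
  env_lift (level_char k) u * env_lift (level_char k) v :> F.
Proof. exact: (env_lift_monoid_morphism (level_char_lie k)).2. Qed.
Let chi_1 : env_lift (level_char k) 1 = 1 :> F.
Proof. exact: (env_lift_monoid_morphism (level_char_lie k)).1. Qed.
Let chi_B u v : env_lift (level_char k) (u - v) =
  env_lift (level_char k) u - env_lift (level_char k) v :> F.
Proof. exact: env_lift_zmod_morphism (level_char_lie k) u v. Qed.
Let chi_D u v : env_lift (level_char k) (u + v) =
  env_lift (level_char k) u + env_lift (level_char k) v :> F.
Proof.
have chi_N w : env_lift (level_char k) (- w) = - env_lift (level_char k) w :> F.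
  by rewrite -sub0r chi_B -[in X in X - _](subrr 0) chi_B subrr sub0r.
by rewrite -[v in LHS]opprK chi_B chi_N opprK.
Qed.

Fact level_scaleA u v c : level_scale u (level_scale v c) = level_scale (u * v) c.
Proof. by rewrite /level_scale chi_M mulrA. Qed.
Fact level_scale1 : left_id 1 level_scale.
Proof. by move=> c; rewrite /level_scale chi_1 mul1r. Qed.
Fact level_scaleDr : right_distributive level_scale +%R.
Proof. by move=> u c d; rewrite /level_scale mulrDr. Qed.
Fact level_scaleDl c : {morph level_scale^~ c : u v / u + v}.
Proof. by move=> u v; rewrite /level_scale chi_D mulrDl. Qed.

HB.instance Definition _ := GRing.Zmodule_isLmodule.Build (env nonneg)
  (level_mod k) level_scaleA level_scale1 level_scaleDr level_scaleDl.
End LevelMod.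

(* The underlying ghat-module of N_{D_l}(k, 0), with its vacuum vector. *)
Definition universal_affine (k : F) := tensor nonneg_env (level_mod k).
HB.instance Definition _ k := GRing.Lmodule.on (universal_affine k).

Definition vacuum (k : F) : universal_affine k :=
  @tens _ _ nonneg_env (level_mod k) 1 (1 : F).

Definition act (k : F) (u : ghat) (v : universal_affine k) :
  universal_affine k := env_in u *: v.

Definition cartan_pred : {pred g} := fun h => is_diag_mx (so_val h).

Lemma cartan_submod_closed : submod_closed cartan_pred.
Proof.
split; first exact: mx0_is_diag.
move=> a x y /is_diag_mxP hx /is_diag_mxP hy; apply/is_diag_mxP => i j ij.
by rewrite !mxE hx // hy // mulr0 addr0.
Qed.

HB.instance Definition _ :=
  GRing.isSubmodClosed.Build F g cartan_pred cartan_submod_closed.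

Record cartan := Cartan { cartan_val :> g; _ : cartan_val \in cartan_pred }.

HB.instance Definition _ := [isSub for cartan_val].
HB.instance Definition _ := [Choice of cartan by <:].
HB.instance Definition _ := [SubChoice_isSubLmodule of cartan by <:].

Definition eps (i : 'I_l) (h : cartan) : F :=
  so_val (cartan_val h) (lshift l i) (lshift l i).

Definition root_space (alpha : cartan -> F) (x : g) : Prop :=
  forall h : cartan, lie (cartan_val h) x = alpha h *: x.

Definition nplus (x : g) : Prop :=
  exists y z : 'I_l -> 'I_l -> g,
    (forall i j : 'I_l, (i < j)%N ->
       root_space (fun h => eps i h - eps j h) (y i j) /\
       root_space (fun h => eps i h + eps j h) (z i j)) /\
    x = \sum_(i < l) \sum_(j < l | (i < j)%N) (y i j + z i j).

(* The root vectors e_(eps_i - eps_j) and e_(eps_i + eps_j); the coordinates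
   i and l + i of C^(2l) are lshift l i and rshift l i. *)
Definition root_sub_mx (i j : 'I_l) : 'M[F]_(l + l) :=
  delta_mx (lshift l i) (lshift l j) - delta_mx (rshift l j) (rshift l i).

Definition root_add_mx (i j : 'I_l) : 'M[F]_(l + l) :=
  delta_mx (lshift l i) (rshift l j) - delta_mx (lshift l j) (rshift l i).

Fact root_sub_subproof i j : root_sub_mx i j \in @so_pred F l.
Proof.
have -> : root_sub_mx i j = block_mx (delta_mx i j) 0 0 (- delta_mx j i).
  apply/matrixP => a b; case: (split_ordP a) => a' ->;
    case: (split_ordP b) => b' ->;
    by rewrite (block_mxEul, block_mxEur, block_mxEdl, block_mxEdr) !mxE
      !eq_shift ?andbF ?subr0 ?sub0r ?subrr ?oppr0.
rewrite unfold_in /soJ tr_block_mx !mulmx_block !trmx0 linearN /= !trmx_delta.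
rewrite !(mul0mx, mulmx0, mul1mx, mulmx1, add0r, addr0) add_block_mx.
by rewrite !addr0 !addNr subrr block_mx0.
Qed.

Fact root_add_subproof i j : root_add_mx i j \in @so_pred F l.
Proof.
have -> : root_add_mx i j = block_mx 0 (delta_mx i j - delta_mx j i) 0 0.
  apply/matrixP => a b; case: (split_ordP a) => a' ->;
    case: (split_ordP b) => b' ->;
    by rewrite (block_mxEul, block_mxEur, block_mxEdl, block_mxEdr) !mxE
      !eq_shift ?andbF ?subr0 ?sub0r ?subrr ?oppr0.
rewrite unfold_in /soJ tr_block_mx !mulmx_block !trmx0 linearB /= !trmx_delta.
rewrite !(mul0mx, mulmx0, mul1mx, mulmx1, add0r, addr0) add_block_mx.
by rewrite !addr0 addrACA -opprD [X in _ - X]addrC subrr block_mx0.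
Qed.

Definition root_sub (i j : 'I_l) : g := So (root_sub_subproof i j).
Definition root_add (i j : 'I_l) : g := So (root_add_subproof i j).

(* Weights are taken with respect to h (x) 1 + C K; the scalars act on the
   left U(ghat)-module through F -> U(ghat). *)
Definition weight_vector (k : F) (v : universal_affine k) : Prop :=
  exists (lam : {linear cartan -> F^o}) (c : F),
    (forall h : cartan,
       act (mode (cartan_val h) 0) v = ((lam h)%:A : env ghat) *: v) /\
    act (central F l) v = (c%:A : env ghat) *: v.

Definition singular (k : F) (v : universal_affine k) : Prop :=
  [/\ v <> 0, weight_vector v,
      forall x : g, nplus x -> act (mode x 0) v = 0 &
      forall p : {malg g[int]}, (forall m : int, m <= 0 -> p@_m = 0) ->
        act ((p, 0) : ghat) v = 0].

(* With i1 the first index: sum_(i <> i1) e_(eps_i1 - eps_i)(-1)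
   e_(eps_i1 + eps_i)(-1) in U(ghat). *)
Definition singular_op (i1 : 'I_l) : env ghat :=
  \sum_(i < l | (i1 < i)%N)
    env_in (mode (root_sub i1 i) (-1)) * env_in (mode (root_add i1 i) (-1)).
End Vacuum.

Definition first_index (l : nat) (hl : (4 <= l)%N) : 'I_l :=
  Ordinal (leq_trans (isT : (0 < 4)%N) hl).

(* Main.v *)
Require Import Defs.
From HB Require Import structures.
From mathcomp Require Import all_boot all_order all_algebra.
From mathcomp Require Import finmap monalg.
From mathcomp Require Import boolp reals functions.
From mathcomp Require Import complex.
From mathcomp Require Import ring zify.

Set Implicit Arguments.
Unset Strict Implicit.
Unset Printing Implicit Defensive.

Import Order.TTheory GRing.Theory Num.Theory.
Local Open Scope ring_scope.

(** Write o for the coordinate 1 of C^(2l), c' for the coordinate exchanged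
    with c (i' = l + i), and w_c for the root vector E_(o,c) - E_(c',o').
    The w_c with c different from o and o' span an abelian subalgebra, on
    which so(2l-2) acts by its vector representation, and twice the operator
    of the theorem is the quadratic form T = sum_c w_c(-1) w_(c')(-1).

    Singularity.  T is invariant under so(2l-2), so an element z of the
    parabolic subalgebra stabilising the line of e_o satisfies
    z(0) T^s 1 = 2 s z_(o,o) T^s 1 ([parabolic_power0]), and z(r) with r > 0
    kills T^s 1 ([parabolic_power_pos]).  Brackets [x, w_c] lie in that
    parabolic for every x in g, so moving x(1) across one factor T only
    produces three multiples of the vector P_x = sum_c x_(c,o) w_(c')(-1):
    one from the level, one from the Casimir of so(2l-2) on its vector
    representation ([top_root_casimir]) and one from the weight of T^s 1.
    They add up to
      x(1) T^s 1 = 2 s (k + l - 1 - s) P_x T^(s-1) 1   ([current_power1]),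
    which vanishes for s = n exactly because k = n - l + 1.

    Nonvanishing.  The Poincare-Birkhoff-Witt theorem would say that T^n 1 is
    not zero; a single functional on the induced module is enough.  It comes
    from a module with an evaluation on which g[t] acts through the level
    ([vacuum_functional_neq0]).  Embed so(2l) in gl(2l), and let gl(2l)[t, 1/t]
    act on the Sato Grassmannian of C^(2l)((t)).  The points of its big cell
    are the graphs of maps from V_+ to V_-; if Pi is the projection
    to such a graph along V_-, the action is the vector field
    D_X Pi = (1 - Pi) X Pi.  This can be checked on polynomial functions,
    where D_X is a derivation, and adding the multiplication by a multiple of
    the regularised trace of X Pi gives the central extension at any level
    ([cell_op_lie]): the cocycle is a boundary term of a truncated
    double sum ([pot_kernel_boundary]).  At the base point Pi_0 the vector
    fields of g[t] vanish.  On the coordinates of the block from t^0 to t^(-1)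
    the currents x(-1) act as constant vector fields, so the operator of the
    theorem becomes a second order operator with constant coefficients, and it
    does not annihilate a well chosen monomial ([singular_op_monomial]). *)

(** * Formal sums *)

Lemma malgU_scale (K : choiceType) (R : nzRingType) (c : R) (k : K) :
  << c *g k >> = c *: << 1 *g k >> :> {malg R[K]}.
Proof. by apply/malgP => k'; rewrite mcoeffZ !mcoeffU mulrnAr mulr1. Qed.

Section MalgSum.
Variables (K : choiceType) (V T : zmodType) (E : K -> V -> T).
Hypothesis ED : forall k, {morph E k : x y / x + y}.

Definition malg_sum (p : {malg V[K]}) : T := \sum_(k <- msupp p) E k p@_k.

Let E0 k : E k 0 = 0.
Proof. by apply: (@addrI _ (E k 0)); rewrite -ED !addr0. Qed.

Lemma malg_sumw (d : {fset K}) p : (msupp p `<=` d)%fset ->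
  malg_sum p = \sum_(k <- d) E k p@_k.
Proof.
by move=> h; rewrite /malg_sum (big_fset_incl _ h) // => k _ /mcoeff_outdom ->.
Qed.

Lemma malg_sumD p q : malg_sum (p + q) = malg_sum p + malg_sum q.
Proof.
pose d := (msupp p `|` msupp q)%fset.
rewrite (@malg_sumw d (p + q)) ?msuppD_le // (@malg_sumw d p) ?fsubsetUl //.
rewrite (@malg_sumw d q) ?fsubsetUr // -big_split.
by apply: eq_bigr => k _; rewrite mcoeffD ED.
Qed.

Lemma malg_sum0 : malg_sum 0 = 0.
Proof. by rewrite /malg_sum msupp0 big_seq_fset0. Qed.

Lemma malg_sumU x k : malg_sum << x *g k >> = E k x.
Proof.
by rewrite (@malg_sumw [fset k])%fset ?msuppU_le // big_seq_fset1 mcoeffUU.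
Qed.
End MalgSum.

(** * Functionals on the induced module *)

(** Endomorphisms with the opposite product.  Vector fields represent a Lie
    algebra antihomomorphically, which the opposite product repairs.  Moreover
    (u x) f = x (u f), so a functional that is an eigenvector of the operator
    x gives u |-> ev (u f), equivariant under right multiplication by x, as
    functionals on an induced module are. *)
Section OppositeEndomorphisms.
Variables (F : comNzRingType) (V : lalgType F).

Definition endo_pred : {pred V -> V} := fun f => `[< linear f >].

Lemma endo_submod_closed : submod_closed endo_pred.
Proof.
split; first by apply/asboolP => a x y; rewrite /= scaler0 addr0.
move=> a f g /asboolP hf /asboolP hg; apply/asboolP => b x y.
have E z : (a *: f + g) z = a *: f z + g z by [].
rewrite !E hf hg.
rewrite !scalerDr !scalerA [a * b]mulrC -!addrA; congr (_ + _).
by rewrite addrCA.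
Qed.

HB.instance Definition _ :=
  GRing.isSubmodClosed.Build F (V -> V) endo_pred endo_submod_closed.

Record endo := Endo { endo_fun :> V -> V; _ : endo_fun \in endo_pred }.

HB.instance Definition _ := [isSub for endo_fun].
HB.instance Definition _ := [Choice of endo by <:].
HB.instance Definition _ := [SubChoice_isSubLmodule of endo by <:].

Lemma endo_linear (f : endo) : linear f.
Proof. by case: f => f /= /asboolP. Qed.

HB.instance Definition _ (f : endo) :=
  GRing.isLinear.Build F V V _ (endo_fun f) (endo_linear f).

Lemma endoP (f g : endo) : f =1 g -> f = g.
Proof. by move=> h; apply/val_inj/funext. Qed.

Fact endo_one_subproof : id \in endo_pred.
Proof. exact/asboolP. Qed.
Definition endo_one : endo := Endo endo_one_subproof.

Fact endo_mul_subproof (f g : endo) : (fun x => g (f x)) \in endo_pred.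
Proof. by apply/asboolP => a x y; rewrite !linearP. Qed.
Definition endo_mul (f g : endo) : endo := Endo (endo_mul_subproof f g).

Fact endo_mulA : associative endo_mul.
Proof. by move=> f g h; apply: endoP. Qed.
Fact endo_mul1 : left_id endo_one endo_mul.
Proof. by move=> f; apply: endoP. Qed.
Fact endo_mulr1 : right_id endo_one endo_mul.
Proof. by move=> f; apply: endoP. Qed.
Fact endo_mulDl : left_distributive endo_mul +%R.
Proof. by move=> f g h; apply: endoP => x; rewrite /= linearD. Qed.
Fact endo_mulDr : right_distributive endo_mul +%R.
Proof. by move=> f g h; apply: endoP. Qed.
Fact endo_one_neq0 : endo_one != 0.
Proof.
apply/eqP => /(congr1 (fun f : endo => f 1)) /eqP.
by rewrite (oner_eq0 V).
Qed.

HB.instance Definition _ := GRing.Zmodule_isNzRing.Build endo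
  endo_mulA endo_mul1 endo_mulr1 endo_mulDl endo_mulDr endo_one_neq0.

Fact endo_scaleAl (a : F) (f g : endo) : a *: (f * g) = (a *: f) * g.
Proof. by apply: endoP => x; rewrite /= linearZ. Qed.
HB.instance Definition _ := GRing.Lmodule_isLalgebra.Build F endo endo_scaleAl.
Fact endo_scaleAr (a : F) (f g : endo) : a *: (f * g) = f * (a *: g).
Proof. exact: endoP. Qed.
HB.instance Definition _ := GRing.Lalgebra_isAlgebra.Build F endo endo_scaleAr.

Lemma endoM (f g : endo) x : (f * g) x = g (f x).
Proof. by []. Qed.
Lemma endoD (f g : endo) x : (f + g) x = f x + g x.
Proof. by []. Qed.
Lemma endoB (f g : endo) x : (f - g) x = f x - g x.
Proof. by []. Qed.
Lemma endoZ a (f : endo) x : (a *: f) x = a *: f x.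
Proof. by []. Qed.

End OppositeEndomorphisms.

Section TensorAction.
Variables (A B : nzRingType) (phi : {rmorphism A -> B}) (V : lmodType A).

Lemma scale_tens_sym (c b : B) (v : V) : c *: tens_sym b v = tens_sym (c * b) v.
Proof. by apply/malgP => w; rewrite mcoeffZ !mcoeffU mulrnAr. Qed.

Lemma scale_tens1 (a : A) (v : V) : phi a *: tens phi 1 v = tens phi 1 (a *: v).
Proof.
rewrite -[LHS]/(tens_scale _ (tens_pi _ _)) -tens_piZ scale_tens_sym mulr1.
by apply/tens_piP/submod_gen_in; rewrite -[phi a]mul1r; exact: tens_rel_bal.
Qed.
End TensorAction.

Section TensorFunctional.
Variables (A B : nzRingType) (phi : {rmorphism A -> B}) (V : lmodType A).
Variables (T : zmodType) (beta : B -> V -> T).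
Hypothesis betaDl : forall b b' v, beta (b + b') v = beta b v + beta b' v.
Hypothesis betaDr : forall b v v', beta b (v + v') = beta b v + beta b v'.
Hypothesis beta_bal : forall b a v, beta (b * phi a) v = beta b (a *: v).

Let ext : tens_free B V -> T := malg_sum (fun v b => beta b v).

Let betaD v : {morph beta^~ v : b b' / b + b'}.
Proof. by move=> b b'; exact: betaDl. Qed.

Let extD p p' : ext (p + p') = ext p + ext p'.
Proof. exact: (malg_sumD betaD). Qed.

Let ext0 : ext 0 = 0.
Proof. exact: malg_sum0. Qed.

Let extB p p' : ext (p - p') = ext p - ext p'.
Proof. by apply/eqP; rewrite eq_sym subr_eq -extD subrK. Qed.

Let ext_sym b v : ext (tens_sym b v) = beta b v.
Proof. exact: (malg_sumU betaD). Qed.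

Let ext_rel w : submod_gen (tens_rel phi (V := V)) w ->
  forall c, ext (c *: w) = 0.
Proof.
elim=> {w} [w []|c|x y _ hx _ hy c|a x _ hx c].
- move=> b v v' c; rewrite scalerBr scalerDr !scale_tens_sym.
  by rewrite extB extD !ext_sym betaDr subrr.
- move=> b a v c; rewrite scalerBr !scale_tens_sym extB !ext_sym mulrA beta_bal.
  exact: subrr.
- by rewrite scaler0 ext0.
- by rewrite scalerBr extB hx hy subrr.
- by rewrite scalerA hx.
Qed.

(** A pairing that is additive and balanced factors through the tensor
    product.  The relations generate a left submodule, so the factorisation
    must be checked after multiplication by an arbitrary scalar, whence the
    quantification over all multiples inside the proof. *)
Lemma tens_neq0 b v : beta b v != 0 -> b *: tens phi 1 v <> 0.
Proof.
move=> /eqP h; rewrite -[_ *: _]/(tens_scale b (tens_pi phi _)) -tens_piZ.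
rewrite scale_tens_sym mulr1 => e; apply: h; rewrite -ext_sym.
have /tens_piP : tens_pi phi (tens_sym b v) = tens_pi phi 0.
  by rewrite e -[0 in RHS](subrr 0) tens_piB subrr.
by rewrite subr0 => /ext_rel /(_ 1); rewrite scale1r.
Qed.
End TensorFunctional.

Lemma env_ind (F : comNzRingType) (L : lieAlgType F) (P : env L -> Prop) :
    P 1 -> (forall u v, P u -> P v -> P (u + v)) ->
    (forall a u, P u -> P (a *: u)) ->
    (forall x u, P u -> P (env_in x * u)) ->
  forall u, P u.
Proof.
move=> P1 PD PZ PM u; rewrite -[u]env_piK.
elim/malg_ind: (repr u) => [|p q hp hq|c m].
- by rewrite env_pi0 -(scale0r 1); apply: PZ.
- by rewrite env_piD; apply: PD.
have -> : << c *g m >> = c *: (<< 1 *g m >> : env_words L).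
  exact: malgU_scale.
rewrite env_piZ; apply: PZ.
case: m; elim=> [|x s IH]; first by rewrite -fmoneE.
have -> : FMonom (x :: s) = mmul (fmu x) (FMonom s).
  by apply/eqP; rewrite fmP fmM fmU.
have -> : << 1 *g mmul (fmu x) (FMonom s) >>
    = env_gen x * << 1 *g FMonom s >> :> env_words L.
  by rewrite [RHS]fgmulUU mulr1.
by rewrite env_piM; apply: PM.
Qed.

Section VacuumFunctional.
Variables (F : fieldType) (l : nat) (k : F).
Variables (V : lalgType F) (rho : affine F l -> endo V) (ev : V -> F).
Hypothesis evD : {morph ev : f g / f + g}.
Hypothesis evZ : forall c f, ev (c *: f) = c * ev f.
Hypothesis rho_lie : lie_to_assoc rho.
Hypothesis ev_nonneg : forall (u : nonneg F l) f,
  ev (rho (nonneg_val u) f) = k * (nonneg_val u).2 * ev f.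

(** The functional w |-> ev (w f) on U(ghat) descends to the induced module,
    because g[t] + CK acts on ev through the character of the level. *)
Lemma vacuum_functional_neq0 (w : env (affine F l)) f :
  ev (env_lift rho w f) != 0 -> w *: vacuum l k <> 0.
Proof.
move=> hw.
pose R (w : env (affine F l)) : endo V := env_lift rho w.
have RB x y : R (x - y) = R x - R y by exact: env_lift_zmod_morphism rho_lie x y.
have R0 : R 0 = 0 by rewrite -(subrr 0) RB subrr.
have RD x y : R (x + y) = R x + R y.
  by rewrite -[y in LHS]opprK RB -[- y]sub0r RB R0 sub0r opprK.
have RM x y : R (x * y) = R x * R y.
  exact: (env_lift_monoid_morphism rho_lie).2.
have R1 : R 1 = 1 by exact: (env_lift_monoid_morphism rho_lie).1.
have RZ a x : R (a *: x) = a *: R x by exact: env_lift_scalable.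
pose beta b (c : level_mod k) : F := (c : F) * ev (R b f).
apply: (@tens_neq0 _ _ (@nonneg_env F l) (level_mod k) _ beta).
- by move=> b b' v; rewrite /beta RD endoD evD /= mulrDr.
- by move=> b v v'; rewrite /beta -mulrDl.
- suff bal a g : ev (R (nonneg_env a) g) = (env_lift (level_char k) a : F) * ev g.
    by move=> b a v; rewrite /beta RM endoM bal mulrCA mulrA.
  pose chi (b : env (nonneg F l)) : F := env_lift (level_char k) b.
  have chiB : {morph chi : x y / x - y}.
    by move=> x y; exact: (env_lift_zmod_morphism (@level_char_lie F l k) x y).
  have chi0 : chi 0 = 0 by rewrite -(subrr 0) chiB subrr.
  have chiD : {morph chi : x y / x + y}.
    by move=> x y; rewrite -[y in LHS]opprK chiB -[- y]sub0r chiB chi0 sub0r opprK.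
  have chiM : {morph chi : x y / x * y}.
    by move=> x y; exact: ((env_lift_monoid_morphism (@level_char_lie F l k)).2 x y).
  have chi1 : chi 1 = 1 by exact: (env_lift_monoid_morphism (@level_char_lie F l k)).1.
  have chiZ (c : F) x : chi (c *: x) = c * chi x.
    exact: (env_lift_scalable (@level_char_lie F l k)).
  rewrite -/(chi a).
  elim/env_ind: a g => [|x y hx hy|c x hx|x y hy] g.
  + by rewrite rmorph1 R1 chi1 mul1r.
  + have e : nonneg_env (x + y) = nonneg_env x + nonneg_env y.
      exact: (raddfD (@nonneg_env F l)).
    by rewrite e (RD (nonneg_env x)) endoD evD (chiD x y) mulrDl -hx -hy.
  + have -> : nonneg_env (c *: x) = c *: nonneg_env x.
      exact: (env_lift_scalable (@nonneg_env_lie F l)).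
    by rewrite (RZ c (nonneg_env x)) endoZ evZ (chiZ c x) -mulrA -hx.
  + have -> : nonneg_env (env_in x * y) = env_in (nonneg_val x) * nonneg_env y.
      rewrite -(env_lift_in (@nonneg_env_lie F l)).
      exact: (rmorphM (@nonneg_env F l)).
    rewrite (RM (env_in (nonneg_val x))) endoM hy (chiM (env_in x)).
    have -> : chi (env_in x) = k * (nonneg_val x).2.
      exact: (env_lift_in (@level_char_lie F l k)).
    have -> : R (env_in (nonneg_val x)) = rho (nonneg_val x).
      exact: (env_lift_in rho_lie).
    by rewrite ev_nonneg mulrA [_ * chi y]mulrC.
- by rewrite /beta mul1r.
Qed.
End VacuumFunctional.

(** * Derivations of a polynomial algebra *)

Lemma coef1M (R : comNzRingType) (a b : {poly R}) :
  (a * b)`_1 = a`_1 * b`_0 + a`_0 * b`_1.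
Proof. by rewrite coefM !big_ord_recr big_ord0 /= add0r addrC. Qed.

Section Derivations.
Variables (F : comNzRingType) (I : choiceType).
Local Notation A := {malg F[{cmonom I}]}.

Definition pvar (i : I) : A := << 1 *g ucm i >>.

Lemma pvar_ind (P : A -> Prop) :
    P 1 -> (forall p q, P p -> P q -> P (p + q)) ->
    (forall c p, P p -> P (c *: p)) -> (forall i p, P p -> P (pvar i * p)) ->
  forall p, P p.
Proof.
move=> P1 PD PZ PM; elim/malg_ind => [|p q|c m].
- by rewrite -(scale0r 1); apply: PZ.
- exact: PD.
rewrite malgU_scale; apply: PZ; elim: {m}(mdeg m) {-2}m (erefl (mdeg m)) => [|d IH] m md.
  by rewrite (mdeg_eq0I md).
have [i mi] : exists i, i \in finsupp m.
  apply/fset0Pn/eqP => h; move: md.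
  by rewrite mdegE h big_seq_fset0.
have e : m = mmul (ucm i) (divcm m (ucm i)).
  apply/eqP/cmP => j; rewrite cmM divcmE cmU.
  by case: eqVneq => [<-|_]; rewrite ?subn0 // subnKC // lt0n cmE_neq0.
have -> : << 1 *g m >> = pvar i * << 1 *g divcm m (ucm i) >> :> A.
  by rewrite [RHS]fgmulUU mulr1 -e.
by apply/PM/IH; move: md; rewrite {1}e mdegM mdegU add1n => -[].
Qed.

Section Eval.
Variables (S : comNzRingType) (f : {rmorphism F -> S}) (s : I -> S).

Definition monom_eval (m : {cmonom I}) : S := \prod_(i <- finsupp m) s i ^+ m i.

Lemma monom_evalw (d : {fset I}) (m : {cmonom I}) : (finsupp m `<=` d)%fset ->
  monom_eval m = \prod_(i <- d) s i ^+ m i.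
Proof.
move=> h; rewrite /monom_eval (big_fset_incl _ h) // => i _.
by rewrite -cmE_eq0 => /eqP ->.
Qed.

Fact monom_eval_mmorphism : mmorphism monom_eval.
Proof.
split=> [m m'|]; last by rewrite /monom_eval mdom1 big_seq_fset0.
pose d := (finsupp m `|` finsupp m')%fset.
rewrite (@monom_evalw d m) ?fsubsetUl // (@monom_evalw d m') ?fsubsetUr //.
rewrite (@monom_evalw d) ?mdomD // -big_split; apply: eq_bigr => i _ /=.
by rewrite cmM exprD.
Qed.

HB.instance Definition _ :=
  isMultiplicative.Build {cmonom I} S monom_eval monom_eval_mmorphism.

Definition peval : A -> S := mmap f monom_eval.
HB.instance Definition _ := GRing.RMorphism.on peval.

Lemma peval_pvar i : peval (pvar i) = s i.
Proof.
rewrite /peval mmapU -[X in X * _]/(f 1) (rmorph1 f) mul1r.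
by rewrite -[LHS]/(monom_eval _) /monom_eval mdomU big_seq_fset1 cmUU.
Qed.

Lemma pevalZ c p : peval (c *: p) = f c * peval p.
Proof. exact: mmapZ. Qed.
End Eval.

Section Der.
Variable d : I -> A.

Let jet : A -> {poly A} :=
  peval (polyC \o in_alg A) (fun i => (pvar i)%:P + (d i)%:P * 'X).

Let jetC c p : jet (c *: p) = c%:A%:P * jet p.
Proof. exact: pevalZ. Qed.
Let jetM p q : jet (p * q) = jet p * jet q.
Proof. exact: (rmorphM (peval _ _)). Qed.
Let jetD p q : jet (p + q) = jet p + jet q.
Proof. exact: (rmorphD (peval _ _)). Qed.
Let jet1 : jet 1 = 1.
Proof. exact: (rmorph1 (peval _ _)). Qed.
Let jetX i : jet (pvar i) = (pvar i)%:P + (d i)%:P * 'X.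
Proof. exact: peval_pvar. Qed.

Let jet0 p : (jet p)`_0 = p.
Proof.
elim/pvar_ind: p => [|p q hp hq|c p hp|i p hp].
- by rewrite jet1 coef1.
- by rewrite jetD coefD; move: (jet p) (jet q) hp hq => a b -> ->.
- by rewrite jetC coefCM; move: (jet p) hp => a ->; rewrite mulr_algl.
- rewrite jetM coef0M jetX; move: (jet p) hp => a ->.
  by rewrite coefD coefC coefMX addr0.
Qed.

(** A derivation with prescribed values on the variables is the coefficient of
    epsilon in the substitution x_i |-> x_i + epsilon d_i; the substitution is
    carried out in polynomials in one more variable. *)
Lemma der_exists : exists D : A -> A,
  [/\ linear D, forall p q, D (p * q) = D p * q + p * D q
    & forall i, D (pvar i) = d i].
Proof.
have : exists J : A -> {poly A}, [/\ forall c p, J (c *: p) = c%:A%:P * J p,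
    forall p q, J (p * q) = J p * J q, forall p q, J (p + q) = J p + J q,
    forall i, J (pvar i) = (pvar i)%:P + (d i)%:P * 'X
    & forall p, (J p)`_0 = p].
  by exists jet.
case=> J [JZ JM JD JX J0]; exists (fun p => (J p)`_1); split.
- by move=> c p q; rewrite JD coefD JZ coefCM mulr_algl.
- by move=> p q; rewrite JM coef1M !J0.
- by move=> i; rewrite JX coefD coefC coefMX /= add0r coefC.
Qed.

End Der.

End Derivations.

Definition leibniz (F : comNzRingType) (A : comAlgType F) (D : endo A) : Prop :=
  forall f g : A, D (f * g) = D f * g + f * D g.

Section LeibnizTheory.
Variables (F : comNzRingType) (A : comAlgType F).
Implicit Types D E : endo A.

Lemma leibniz_comb (a : F) D E :
  leibniz D -> leibniz E -> leibniz (a *: D + E).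
Proof.
move=> hD hE f g; rewrite !endoD !endoZ hD hE scalerDr scalerAl scalerAr.
by rewrite mulrDl mulrDr !addrA; congr (_ + _); rewrite addrAC.
Qed.

Lemma leibniz_commutator D E :
  leibniz D -> leibniz E -> leibniz (D * E - E * D).
Proof.
move=> hD hE f g; rewrite !endoB !endoM !hD !hE !linearD /= !hD !hE; ring.
Qed.

Lemma leibniz1 D : leibniz D -> D 1 = 0.
Proof.
by move=> hD; apply: (@addrI _ (D 1)); rewrite addr0 -{3}[1]mulr1 hD mulr1 mul1r.
Qed.

Lemma leibnizX D f n : leibniz D -> D (f ^+ n.+1) = f ^+ n * D f *+ n.+1.
Proof.
move=> hD; elim: n => [|n IH]; first by rewrite expr1 expr0 mul1r.
by rewrite exprS hD IH mulrnAr mulrA -exprS [D f * _]mulrC -mulrS.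
Qed.

Lemma leibniz_mulmx D m n p (B : 'M[A]_(m, n)) (C : 'M[A]_(n, p)) : leibniz D ->
  map_mx D (B *m C) = map_mx D B *m C + B *m map_mx D C.
Proof.
move=> hD; apply/matrixP => i j; rewrite !mxE linear_sum /= -big_split.
by apply: eq_bigr => k _; rewrite !mxE hD.
Qed.

Lemma leibniz_const D m n (x : 'M[F]_(m, n)) : leibniz D ->
  map_mx D (map_mx (in_alg A) x) = 0.
Proof.
by move=> hD; apply/matrixP => i j; rewrite !mxE linearZ /= leibniz1 // scaler0.
Qed.

Fact mulop_subproof (a : A) : ( *%R a : A -> A) \in @endo_pred F A.
Proof. by apply/asboolP => c f g; rewrite mulrDr scalerAr. Qed.
Definition mulop (a : A) : endo A := Endo (mulop_subproof a).

End LeibnizTheory.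

(** * Vector fields on the big cell *)

Lemma sumr_nat_eq0 (V : zmodType) (E : nat -> V) (b c : nat) :
  (forall r, (b <= r < c)%N -> E r = 0) -> \sum_(b <= r < c) E r = 0.
Proof. by move=> h; rewrite big_nat big1. Qed.

Lemma sumr_nat_trunc (V : zmodType) (E : nat -> V) (b c : nat) :
  (b <= c)%N -> (forall r, (b <= r)%N -> E r = 0) ->
  \sum_(0 <= r < c) E r = \sum_(0 <= r < b) E r.
Proof.
move=> bc E0; rewrite (big_cat_nat (leq0n b) bc) /=.
by rewrite [X in _ + X]sumr_nat_eq0 ?addr0 // => r /andP[/E0].
Qed.

Section BigCell.
Variables (F : fieldType) (N : nat) (A : comAlgType F).
Local Notation I := (nat * nat * ('I_N * 'I_N))%type.
Variable t : I -> A.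

(** The block at (t^p, t^q) of the projection Pi onto the graph of a map
    from V_+ to V_-, along V_-: the identity on V_+, zero on V_-, and the
    coordinates t as the lower left block.  The index [Negz i] is
    t^(-(i+1)). *)
Definition graph_proj (p q : int) : 'M[A]_N :=
  match q, p with
  | Negz _, _ => 0
  | Posz j, Posz i => if i == j then 1%:M else 0
  | Posz j, Negz i => \matrix_(a, b) t (i, j, (a, b))
  end.
Local Notation Pi := graph_proj.
Local Notation sc := (map_mx (in_alg A)).

Arguments graph_proj : simpl never.

Lemma graph_proj_ge0 (p : int) (q : nat) : 0 <= p ->
  Pi p q = if p == q then 1%:M else 0.
Proof. by case: p => // i _; rewrite /Pi eqz_nat. Qed.

Implicit Types (x y : 'M[F]_N) (m n p : int) (q r : nat).

(** The block at (t^p, t^q) of (1 - Pi) X Pi, for X = x t^m.  The product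
    Pi X Pi involves an infinite sum, of which all terms past the bound
    vanish. *)
Definition cell_field x m p q : 'M[A]_N :=
  sc x *m Pi (p - m) q
    - \sum_(0 <= r < (absz m + q).+1) Pi p r *m sc x *m Pi (r%:Z - m) q.

(** Freedom in the truncation: commutators compare double sums that were
    truncated at different places. *)
Lemma cell_fieldE x m p q R : (absz m + q < R)%N ->
  cell_field x m p q =
    sc x *m Pi (p - m) q
      - \sum_(0 <= r < R) Pi p r *m sc x *m Pi (r%:Z - m) q.
Proof.
move=> hR; rewrite /cell_field [in RHS](@sumr_nat_trunc _ _ (absz m + q).+1) //.
move=> r hr; rewrite (@graph_proj_ge0 (r%:Z - m)); last by lia.
by rewrite ifF ?mulmx0 //; lia.
Qed.

(** The field is tangent to the big cell: the identity block of Pi is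
    constant. *)
Lemma cell_field_ge0 x m p q : 0 <= p -> cell_field x m p q = 0.
Proof.
case: p => // p _; rewrite (@cell_fieldE _ _ _ _ (absz m + q + p).+1); last by lia.
have hp : (p.+1 <= (absz m + q + p).+1)%N by lia.
rewrite (big_cat_nat (leq0n _) hp) big_nat_recr //=.
rewrite (@graph_proj_ge0 p p) // eqxx mul1mx.
rewrite !sumr_nat_eq0 => [|r hr|r hr]; first by rewrite add0r addr0 subrr.
  by rewrite graph_proj_ge0 // ifF ?mul0mx //; lia.
by rewrite graph_proj_ge0 // ifF ?mul0mx //; lia.
Qed.

Lemma cell_fieldP a x y m p q :
  cell_field (a *: x + y) m p q
    = a%:A *: cell_field x m p q + cell_field y m p q.
Proof.
rewrite /cell_field; have -> : sc (a *: x + y) = a%:A *: sc x + sc y.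
  by apply/matrixP => i j; rewrite !mxE rmorphD rmorphM /= mulr_algl.
rewrite mulmxDl -scalemxAl scalerBr scaler_sumr addrACA -opprD -big_split /=.
congr (_ - _); apply: eq_bigr => r _.
by rewrite mulmxDr mulmxDl -scalemxAr -scalemxAl.
Qed.

(** The trace of the upper right block of X times the graph map, that is the
    trace of X (Pi - Pi_0). *)
Definition cell_pot x m : A :=
  if m is Posz n then \sum_(0 <= r < n) \tr (sc x *m Pi (r%:Z - m) r) else 0.

(** The trace of X Pi truncated at R differs from the potential only by the
    trace of X Pi_0, which is seen only at m = 0. *)
Lemma cell_potE x m R : (absz m <= R)%N ->
  cell_pot x m = \sum_(0 <= r < R) \tr (sc x *m Pi (r%:Z - m) r)
    - ((m == 0)%:R * \tr x *+ R)%:A.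
Proof.
case: m => n hn; rewrite /cell_pot /=; last first.
  rewrite mul0r mul0rn scale0r subr0 sumr_nat_eq0 // => r _.
  by rewrite graph_proj_ge0 // ifF ?mulmx0 ?mxtrace0 //; lia.
have [->|n0] := eqVneq n 0.
  rewrite big_geq // mul1r; apply/esym/eqP; rewrite subr_eq0; apply/eqP.
  rewrite (eq_bigr (fun=> (\tr x)%:A)) => [|r _].
    by rewrite sumr_const_nat subn0 scalerMnl.
  by rewrite subr0 graph_proj_ge0 // eqxx mulmx1 trace_map_mx.
rewrite (@sumr_nat_trunc _ _ n R) //.
  by rewrite eqz_nat (negPf n0) mul0r mul0rn scale0r subr0.
move=> r hr; rewrite graph_proj_ge0; last by lia.
by rewrite ifF ?mulmx0 ?mxtrace0 //; lia.
Qed.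

Section Derivative.
Variables (D : endo A) (y : 'M[F]_N) (n : int).
Hypothesis DL : leibniz D.
Hypothesis Dt : forall i j a b, D (t (i, j, (a, b))) = cell_field y n (Negz i) j a b.

Lemma derive_graph_proj (p : int) (q : nat) : map_mx D (Pi p q) = cell_field y n p q.
Proof.
case: p => p; last by apply/matrixP => a b; rewrite -Dt !mxE.
rewrite cell_field_ge0 // graph_proj_ge0 //.
apply/matrixP => a b; rewrite !mxE; case: ifP => _; rewrite !mxE ?linear0 //.
by case: (a == b); rewrite ?linear0 // leibniz1.
Qed.

(** All terms but the first are symmetric under the exchange of (x, m) and
    (y, n), so they disappear from the commutator.  The two double sums carry
    the bounds R and R + R in opposite orders: in the derivative of the first
    factor the bound of the inner sum must exceed the outer index by |n|. *)
Lemma derive_cell_field x m p q R : (absz m + absz n + q < R)%N ->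
  map_mx D (cell_field x m p q) =
    cell_field (x *m y) (m + n) p q
    - \sum_(0 <= s < R) sc x *m Pi (p - m) s *m sc y *m Pi (s%:Z - n) q
    - \sum_(0 <= r < R) sc y *m Pi (p - n) r *m sc x *m Pi (r%:Z - m) q
    + \sum_(0 <= r < R) \sum_(0 <= s < R + R)
        Pi p s *m sc y *m Pi (s%:Z - n) r *m sc x *m Pi (r%:Z - m) q
    + \sum_(0 <= r < R + R) \sum_(0 <= s < R)
        Pi p r *m sc x *m Pi (r%:Z - m) s *m sc y *m Pi (s%:Z - n) q.
Proof.
move=> hR; rewrite (@cell_fieldE _ _ _ _ R); last by lia.
rewrite raddfB raddf_sum /= leibniz_mulmx // leibniz_const // mul0mx add0r.
rewrite derive_graph_proj (@cell_fieldE _ _ _ _ R); last by lia.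
rewrite (@cell_fieldE _ _ _ _ (R + R)); last by lia.
have -> : \sum_(0 <= r < R) map_mx D (Pi p r *m sc x *m Pi (r%:Z - m) q)
  = \sum_(0 <= r < R) cell_field y n p r *m sc x *m Pi (r%:Z - m) q
  + \sum_(0 <= r < R + R) Pi p r *m sc x *m cell_field y n (r%:Z - m) q.
  rewrite [X in _ + X](@sumr_nat_trunc _ _ R) ?leq_addr //; last first.
    by move=> r hr; rewrite cell_field_ge0 ?mulmx0 //; lia.
  rewrite -big_split; apply: eq_bigr => r _ /=.
  rewrite !leibniz_mulmx // leibniz_const // !derive_graph_proj.
  by rewrite mulmx0 addr0.
have -> : \sum_(0 <= r < R) cell_field y n p r *m sc x *m Pi (r%:Z - m) q
  = \sum_(0 <= r < R) sc y *m Pi (p - n) r *m sc x *m Pi (r%:Z - m) q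
  - \sum_(0 <= r < R) \sum_(0 <= s < R + R)
        Pi p s *m sc y *m Pi (s%:Z - n) r *m sc x *m Pi (r%:Z - m) q.
  rewrite -sumrB !big_nat; apply: eq_bigr => r /andP[_ hr].
  rewrite (@cell_fieldE _ _ _ _ (R + R)); last by lia.
  by rewrite !mulmxBl !mulmx_suml.
have -> : \sum_(0 <= r < R + R) Pi p r *m sc x *m cell_field y n (r%:Z - m) q
  = \sum_(0 <= r < R + R) Pi p r *m sc (x *m y) *m Pi (r%:Z - (m + n)) q
  - \sum_(0 <= r < R + R) \sum_(0 <= s < R)
        Pi p r *m sc x *m Pi (r%:Z - m) s *m sc y *m Pi (s%:Z - n) q.
  rewrite -sumrB; apply: eq_bigr => r _.
  rewrite (@cell_fieldE _ _ _ _ R); last by lia.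
  rewrite mulmxBr mulmx_sumr map_mxM !mulmxA.
  have -> : r%:Z - (m + n) = r%:Z - m - n by lia.
  congr (_ - _).
  by apply: eq_bigr => s _; rewrite !mulmxA.
rewrite mulmxBr mulmx_sumr map_mxM !mulmxA.
have -> : p - (m + n) = p - m - n by lia.
have -> : \sum_(0 <= r < R) sc x *m (Pi (p - m) r *m sc y *m Pi (r%:Z - n) q)
  = \sum_(0 <= s < R) sc x *m Pi (p - m) s *m sc y *m Pi (s%:Z - n) q.
  by apply: eq_bigr => s _; rewrite !mulmxA.
set a1 := sc x *m _ *m _; set a2 := \sum_(_ <= _ < _) _.
set a3 := \sum_(_ <= _ < _) _; set a4 := \sum_(_ <= _ < _) _.
set a5 := \sum_(_ <= _ < _) _; set a6 := \sum_(_ <= _ < _) _.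
apply/matrixP => i j; rewrite !mxE; ring.
Qed.

Definition pot_kernel x m y n (r s : nat) : A :=
  \tr (sc x *m Pi (r%:Z - m) s *m sc y *m Pi (s%:Z - n) r).

Lemma derive_cell_pot x m R : (absz m + absz n < R)%N ->
  D (cell_pot x m) =
    \sum_(0 <= r < R) \tr (sc (x *m y) *m Pi (r%:Z - (m + n)) r)
    - \sum_(0 <= r < R) \sum_(0 <= s < R + R) pot_kernel x m y n r s.
Proof.
move=> hR; rewrite (@cell_potE _ _ R); last by lia.
rewrite linearB linear_sum linearZ /= leibniz1 // scaler0 subr0 -sumrB !big_nat.
apply: eq_bigr => r /andP[_ hr].
have -> (B : 'M[A]_N) : D (\tr B) = \tr (map_mx D B).
  by rewrite linear_sum; apply: eq_bigr => i _; rewrite mxE.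
rewrite leibniz_mulmx // leibniz_const // mul0mx add0r derive_graph_proj.
rewrite (@cell_fieldE _ _ _ _ (R + R)); last by lia.
rewrite mulmxBr mulmx_sumr (raddfB (@mxtrace A N)) (raddf_sum (@mxtrace A N)) /=.
rewrite map_mxM !mulmxA.
have -> : r%:Z - (m + n) = r%:Z - m - n by lia.
by congr (_ - _); apply: eq_bigr => s _; rewrite /pot_kernel !mulmxA.
Qed.

End Derivative.

Lemma pot_kernelC x m y n r s : pot_kernel x m y n r s = pot_kernel y n x m s r.
Proof. by rewrite /pot_kernel -!mulmxA mulmxA mxtrace_mulC !mulmxA. Qed.

Definition pos_part (n : int) : nat := if n is Posz k then k else 0%N.

(** The source of the central extension: the kernel has infinitely many nonzero
    terms, and its two iterated sums, truncated, differ by such boundary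
    terms. *)
Lemma pot_kernel_boundary x m y n R : (absz m + absz n < R)%N ->
  \sum_(0 <= r < R) \sum_(R <= s < R + R) pot_kernel x m y n r s =
    ((m + n == 0)%:R * \tr (x *m y) *+ pos_part n)%:A.
Proof.
move=> hR; pose c := (m + n == 0)%:R * \tr (x *m y).
have kE r s : (r < R)%N -> (R <= s)%N ->
    pot_kernel x m y n r s = if s%:Z == r%:Z + n then c%:A else 0.
  move=> hr hs; rewrite /pot_kernel (@graph_proj_ge0 (s%:Z - n)); last by lia.
  have [e|e] := eqVneq (s%:Z - n) r; last first.
    by rewrite ifF ?mulmx0 ?mxtrace0 //; lia.
  rewrite ifT; last by lia.
  rewrite (@graph_proj_ge0 (r%:Z - m)); last by lia.
  rewrite mulmx1 /c; have [e'|e'] := eqVneq (m + n) 0.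
    by rewrite ifT ?mulmx1 -?map_mxM ?trace_map_mx ?mul1r //; lia.
  by rewrite ifF ?mulmx0 ?mul0mx ?mxtrace0 ?mul0r ?scale0r //; lia.
rewrite -/c; case: n @c kE hR => k c kE hR /=; last first.
  rewrite mulr0n scale0r sumr_nat_eq0 // => r hr.
  rewrite sumr_nat_eq0 // => s hs; rewrite kE; try lia.
  by rewrite ifF //; lia.
have hk : (R - k <= R)%N by lia.
rewrite (big_cat_nat (leq0n _) hk) /= sumr_nat_eq0 ?add0r; last first.
  move=> r hr; rewrite sumr_nat_eq0 // => s hs; rewrite kE; try lia.
  by rewrite ifF //; lia.
rewrite big_nat (eq_bigr (fun=> c%:A)) => [|r hr].
  by rewrite -big_nat sumr_const_nat scalerMnl; congr (_ *+ _ *: _); lia.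
rewrite (bigD1_seq (r + k)%N) ?mem_index_iota ?iota_uniq //=; last by lia.
rewrite kE; try lia.
rewrite ifT; last by lia.
rewrite big_nat_cond big1 ?addr0 // => s /andP[hs sr].
by rewrite kE ?ifF //; lia.
Qed.

(** Formally both derivatives contain the same trace of X Pi Y Pi.  Truncated,
    they differ by the trace of x y times max(n, 0) and times max(m, 0), and
    the difference of these two numbers is -m when m + n = 0. *)
Lemma cell_pot_cocycle (DX DY : endo A) x y m n :
    leibniz DX -> leibniz DY ->
    (forall i j a b, DX (t (i, j, (a, b))) = cell_field x m (Negz i) j a b) ->
    (forall i j a b, DY (t (i, j, (a, b))) = cell_field y n (Negz i) j a b) ->
  DY (cell_pot x m) - DX (cell_pot y n) =
    cell_pot (x *m y - y *m x) (m + n)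
      + (m%:~R * (m + n == 0)%:R * \tr (x *m y))%:A.
Proof.
move=> LX LY tX tY; pose R := (absz m + absz n).+1.
rewrite (@derive_cell_pot _ _ _ LY tY x m R) //.
rewrite (@derive_cell_pot _ _ _ LX tX y n R); last by rewrite addnC.
rewrite (@cell_potE _ _ R); last by lia.
have -> : \tr (x *m y - y *m x) = 0.
  by rewrite (raddfB (@mxtrace F N)) /= mxtrace_mulC subrr.
have split_sum (K : nat -> nat -> A) : \sum_(0 <= r < R) \sum_(0 <= s < R + R) K r s
   = \sum_(0 <= r < R) \sum_(0 <= s < R) K r s
     + \sum_(0 <= r < R) \sum_(R <= s < R + R) K r s.
  rewrite -big_split; apply: eq_bigr => r _ /=.
  by rewrite -big_cat_nat ?leq_addr.
rewrite !split_sum !pot_kernel_boundary /R; try lia.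
have -> : \sum_(0 <= r < R) \sum_(0 <= s < R) pot_kernel y n x m r s
    = \sum_(0 <= r < R) \sum_(0 <= s < R) pot_kernel x m y n r s.
  rewrite exchange_big; apply: eq_bigr => r _; apply: eq_bigr => s _.
  exact: pot_kernelC.
rewrite mulr0 mul0rn scale0r subr0.
rewrite [in RHS](eq_bigr (fun r => \tr (sc (x *m y) *m Pi (r%:Z - (m + n)) r)
    - \tr (sc (y *m x) *m Pi (r%:Z - (m + n)) r))); last first.
  have scB (u v : 'M[F]_N) : sc (u - v) = sc u - sc v.
    by apply/matrixP => i j; rewrite !mxE rmorphB.
  move=> r _; rewrite scB.
  by rewrite mulmxBl (raddfB (@mxtrace A N)).
rewrite sumrB.
rewrite [n + m]addrC [\tr (y *m x)]mxtrace_mulC.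

have -> : m%:~R * (m + n == 0)%:R * \tr (x *m y) =
    (m + n == 0)%:R * \tr (x *m y) *+ pos_part m
    - (m + n == 0)%:R * \tr (x *m y) *+ pos_part n.
  have [e|_] := eqVneq (m + n) 0; last by rewrite mulr0 !mul0r !mul0rn subrr.
  have -> : m%:~R = (pos_part m)%:R - (pos_part n)%:R :> F.
    have -> : n = - m by lia.
    by case: m {tX e R split_sum} => [[|k]|k]; rewrite /= ?subr0 ?sub0r // NegzE mulrNz.
  by rewrite mulr1 mul1r mulrBl !mulr_natl.
rewrite scalerBl /R.
set a := \sum_(_ <= _ < _) \tr _; set b := \sum_(_ <= _ < _) \tr _.
set c := \sum_(_ <= _ < _) _; set u := _%:A; set v := _%:A.
by rewrite opprB opprD; ring.
Qed.
End BigCell.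

(** * The affine algebra acting on functions on the big cell *)

(** The polynomial algebra enters through its generators: an induction
    principle and the existence of derivations with given values. *)
Section CellRepresentation.
Variables (F : fieldType) (l : nat) (A : comAlgType F).
Local Notation N := (l + l)%N.
Local Notation I := (nat * nat * ('I_(l + l) * 'I_(l + l)))%type.
Variable t : I -> A.
Hypothesis t_ind : forall P : A -> Prop, P 1 ->
  (forall f g, P f -> P g -> P (f + g)) -> (forall c f, P f -> P (c *: f)) ->
  (forall i f, P f -> P (t i * f)) -> forall f, P f.
Hypothesis t_der : forall d : I -> A,
  exists D : endo A, leibniz D /\ forall i, D (t i) = d i.

(** Derivations are determined by the generators, so identities between vector
    fields only have to be verified on coordinates. *)
Lemma leibniz_ext (D E : endo A) : leibniz D -> leibniz E ->
  (forall i, D (t i) = E (t i)) -> D = E.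
Proof.
move=> hD hE DE; apply: endoP; elim/t_ind => [|f g hf hg|c f hf|i f hf].
- by rewrite !leibniz1.
- by rewrite !linearD /= hf hg.
- by rewrite !linearZ /= hf.
- by rewrite hD hE hf DE.
Qed.

Definition cell_der (x : 'M[F]_N) (m : int) : endo A := projT1 (cid (t_der
  (fun i => cell_field t x m (Negz i.1.1) i.1.2 i.2.1 i.2.2))).

Lemma cell_der_leibniz x m : leibniz (cell_der x m).
Proof. by rewrite /cell_der; case: cid => D []. Qed.

Lemma cell_der_gen x m i j a b :
  cell_der x m (t (i, j, (a, b))) = cell_field t x m (Negz i) j a b.
Proof. by rewrite /cell_der; case: cid => D [_ ->]. Qed.

Lemma cell_derP a x y m : cell_der (a *: x + y) m = a *: cell_der x m + cell_der y m.
Proof.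
apply: leibniz_ext => [||[[i j] [u v]]]; [exact: cell_der_leibniz| |].
  by apply: leibniz_comb; exact: cell_der_leibniz.
by rewrite endoD endoZ !cell_der_gen cell_fieldP !mxE mulr_algl.
Qed.

Lemma cell_der_lie x y m n :
  cell_der x m * cell_der y n - cell_der y n * cell_der x m
    = cell_der (x *m y - y *m x) (m + n).
Proof.
have [hx hy] := (@cell_der_leibniz x m, @cell_der_leibniz y n).
apply: leibniz_ext => [||[[i j] [u v]]]; [exact: leibniz_commutator | exact: cell_der_leibniz|].
rewrite endoB !endoM !cell_der_gen.
have entry (D : endo A) (B : 'M[A]_N) : D (B u v) = map_mx D B u v by rewrite mxE.
pose R := (absz m + absz n + j).+1.
rewrite !entry (@derive_cell_field _ _ _ _ _ _ _ hy (@cell_der_gen y n) x m _ _ R) //.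
rewrite (@derive_cell_field _ _ _ _ _ _ _ hx (@cell_der_gen x m) y n _ _ R); last by lia.
have -> : x *m y - y *m x = (-1) *: (y *m x) + x *m y by rewrite scaleN1r addrC.
rewrite cell_fieldP [n + m]addrC.
set C1 := cell_field _ (x *m y) _ _ _; set C2 := cell_field _ (y *m x) _ _ _.
set S1 := \sum_(_ <= _ < _) _; set S2 := \sum_(_ <= _ < _) _.
set S3 := \sum_(_ <= _ < _) _; set S4 := \sum_(_ <= _ < _) _.
set S5 := \sum_(_ <= _ < _) _; set S6 := \sum_(_ <= _ < _) _.
have -> : S4 = S1 by exact: exchange_big.
have -> : S3 = S2 by exact: exchange_big.
by rewrite !mxE mulr_algl scaleN1r; ring.
Qed.

Lemma cell_potP a x y m :
  cell_pot t (a *: x + y) m = a *: cell_pot t x m + cell_pot t y m.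
Proof.
case: m => m /=; last by rewrite scaler0 addr0.
rewrite scaler_sumr -big_split; apply: eq_bigr => r _ /=.
have -> : map_mx (in_alg A) (a *: x + y)
    = a%:A *: map_mx (in_alg A) x + map_mx (in_alg A) y.
  by apply/matrixP => u v; rewrite !mxE rmorphD rmorphM /= mulr_algl.
by rewrite mulmxDl -scalemxAl mxtraceD mxtraceZ mulr_algl.
Qed.

Variable kappa : F.

Definition cell_op (m : int) (x : 'M[F]_N) : endo A :=
  cell_der x m + mulop (kappa *: cell_pot t x m).

Lemma cell_opE m x f : cell_op m x f = cell_der x m f + kappa *: cell_pot t x m * f.
Proof. by []. Qed.

Lemma cell_opP m a x y : cell_op m (a *: x + y) = a *: cell_op m x + cell_op m y.
Proof.
apply: endoP => f; rewrite -[RHS]/(a *: cell_op m x f + cell_op m y f) !cell_opE.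
rewrite cell_derP cell_potP endoD endoZ.
rewrite !scalerDr mulrDl -!scalerAl !scalerA [kappa * a]mulrC.
by rewrite addrACA.
Qed.

Lemma cell_op_lie m n x y :
  cell_op m x * cell_op n y - cell_op n y * cell_op m x
   = cell_op (m + n) (x *m y - y *m x)
     + (kappa * (m%:~R * (m + n == 0)%:R * \tr (x *m y)))%:A.
Proof.
have [hx hy] := (@cell_der_leibniz x m, @cell_der_leibniz y n).
apply: endoP => f; rewrite endoB !endoM.
rewrite [RHS](endoD (cell_op (m + n) (x *m y - y *m x))) !cell_opE -cell_der_lie endoB !endoM.
rewrite !linearD /= hx hy !linearZ /=.
have := cell_pot_cocycle hx hy (@cell_der_gen x m) (@cell_der_gen y n).
set c := m%:~R * _ * _.
rewrite -[((kappa * c) *: _) f]/((kappa * c) *: f) -scalerA -[c *: f]mulr_algl.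
move/eqP; rewrite eq_sym -subr_eq => /eqP <-.
have [K KE] : exists K : A, forall z, kappa *: z = K * z.
  by exists kappa%:A => z; rewrite mulr_algl.
by rewrite !KE; ring.
Qed.

(** The level is twice [kappa] because the form of so(2l) is half the trace of
    gl(2l). *)
Definition affine_op (u : affine F l) : endo A :=
  malg_sum (fun m (x : so F l) => cell_op m (so_val x)) u.1 + (2 * kappa * u.2)%:A.

Let cell_opD m : {morph (fun x : so F l => cell_op m (so_val x)) : x y / x + y}.
Proof.
by move=> x y; have := cell_opP m 1 (so_val x) (so_val y); rewrite !scale1r.
Qed.

Local Notation opsum := (malg_sum (fun m (x : so F l) => cell_op m (so_val x))).

#[local] Opaque loop_lie loop_cocycle malg_sum.

Hypothesis two_neq0 : 2 != 0 :> F.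

Lemma affine_op_loop_lie (p q : {malg (so F l)[int]}) :
  opsum (loop_lie p q) + (2 * kappa * loop_cocycle p q)%:A
    = opsum p * opsum q - opsum q * opsum p.
Proof.
have sD := malg_sumD cell_opD; have s0 := malg_sum0 (fun m (x : so F l) => cell_op m x).
elim/malg_ind: p => [|p p' hp hp'|x m].
- by rewrite loop_lie0l loop_cocycle0l s0 mulr0 scale0r mulr0 mul0r subrr addr0.
- rewrite loop_lieDl loop_cocycleDl (sD (loop_lie p q)) (sD p) mulrDr scalerDl.
  rewrite addrACA [in RHS]mulrDl [in RHS]mulrDr opprD [RHS]addrACA.
  by congr (_ + _); [exact: hp | exact: hp'].
elim/malg_ind: q => [|q q' hq hq'|y n].
- by rewrite loop_lie0r loop_cocycle0r s0 mulr0 scale0r mulr0 mul0r subrr addr0.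
- rewrite loop_lieDr loop_cocycleDr (sD (loop_lie << x *g m >> q)) (sD q).
  rewrite mulrDr scalerDl addrACA [in RHS]mulrDr [in RHS]mulrDl opprD [RHS]addrACA.
  by congr (_ + _); [exact: hq | exact: hq'].
rewrite loop_lieU loop_cocycleU.
rewrite (malg_sumU cell_opD _ m) (malg_sumU cell_opD _ n).
rewrite (malg_sumU cell_opD _ (m + n)) cell_op_lie; congr (_ + _ *: _).
by rewrite /so_form; field.
Qed.

Lemma affine_op_lie_to_assoc : lie_to_assoc affine_op.
Proof.
split=> [a [p c] [q d]|[p c] [q d]]; rewrite /affine_op /=.
  have sD := malg_sumD cell_opD; have s0 := malg_sum0 (fun m (x : so F l) => cell_op m x).
  have sZ : opsum (loop_scale a p) = a *: opsum p.
    elim/malg_ind: p => [|p p' hp hp'|x m].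
    - by rewrite loop_scale0 s0 scaler0.
    - by rewrite loop_scaleD (sD (loop_scale a p)) (sD p) hp hp' scalerDr.
    rewrite loop_scaleU !(malg_sumU cell_opD).
    have e0 : cell_op m 0 = 0.
      by apply: (@addrI _ (cell_op m 0)); rewrite -[LHS](cell_opD m (0 : so F l) 0) !addr0.
    by have := cell_opP m a (so_val x) 0; rewrite !addr0 e0 addr0.
  rewrite (sD (loop_scale a p)) sZ scalerDr addrACA; congr (_ + _).
  by rewrite mulrDr scalerDl scalerA; congr (_ *: _ + _); ring.
rewrite affine_op_loop_lie.
have E (P Q : endo A) (u v : F) :
    (P + u%:A) * (Q + v%:A) = P * Q + (v *: P + (u *: Q + (u * v)%:A)).
  rewrite mulrDr !mulrDl mulr_algl !mulr_algr scalerA [v * u]mulrC -!addrA.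
  by congr (_ + _); rewrite addrCA.
rewrite !E opprD addrACA [_ *: opsum p + (_ *: opsum q + _)]addrCA.
by rewrite [2 * kappa * c * _]mulrC subrr addr0.
Qed.

#[local] Transparent malg_sum.

Variable e0 : {rmorphism A -> F}.
Hypothesis e0Z : forall c f, e0 (c *: f) = c * e0 f.
Hypothesis e0t : forall i, e0 (t i) = 0.

Lemma eval0_graph_proj_neg (p : int) (q : nat) : p < 0 -> map_mx e0 (graph_proj t p q) = 0.
Proof. by case: p => // p _; apply/matrixP => a b; rewrite !mxE e0t. Qed.

(** Loops that are regular at t = 0 preserve V_+, so they fix the base point
    of the cell. *)
Lemma eval0_cell_der m x f : 0 <= m -> e0 (cell_der x m f) = 0.
Proof.
move=> m0; elim/t_ind: f => [|f g hf hg|c f hf|[[i j] [a b]] f hf].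
- by rewrite leibniz1 ?rmorph0 //; exact: cell_der_leibniz.
- by rewrite linearD rmorphD hf hg addr0.
- by rewrite linearZ e0Z hf mulr0.
rewrite cell_der_leibniz rmorphD !rmorphM hf mulr0 addr0 cell_der_gen.
suff -> : e0 (cell_field t x m (Negz i) j a b) = 0 by rewrite mul0r.
suff : map_mx e0 (cell_field t x m (Negz i) j) = 0.
  by move/matrixP/(_ a b); rewrite !mxE.
rewrite /cell_field map_mxB map_mxM eval0_graph_proj_neg; last by lia.
rewrite mulmx0 sub0r raddf_sum big1 ?oppr0 // => r _.
by rewrite /= !map_mxM (@eval0_graph_proj_neg (Negz i)) // !mul0mx.
Qed.

Lemma eval0_cell_pot m x : e0 (cell_pot t x m) = 0.
Proof.
case: m => m /=; last exact: rmorph0.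
rewrite raddf_sum big_nat big1 // => r /andP[_ hr] /=.
by rewrite -trace_map_mx map_mxM eval0_graph_proj_neg ?mulmx0 ?mxtrace0 //; lia.
Qed.

Lemma eval0_affine_op (u : nonneg F l) f :
  e0 (affine_op (nonneg_val u) f) = 2 * kappa * (nonneg_val u).2 * e0 f.
Proof.
have hp : {in msupp (nonneg_val u).1, forall m : int, 0 <= m}.
  by case: (u) => v hv; exact/allP.
have -> : affine_op (nonneg_val u) f =
  opsum (nonneg_val u).1 f + (2 * kappa * (nonneg_val u).2) *: f by [].
rewrite rmorphD e0Z.
rewrite [X in X + _](_ : _ = 0) ?add0r // /malg_sum.
have sumE (s : seq int) (G : int -> endo A) : (\sum_(m <- s) G m) f = \sum_(m <- s) G m f.
  by elim/big_ind2: _ => // D f1 E f2 <- <-.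
rewrite sumE rmorph_sum big_seq big1 // => m /hp hm.
rewrite cell_opE rmorphD eval0_cell_der // rmorphM e0Z eval0_cell_pot.
by rewrite mulr0 mul0r addr0.
Qed.
End CellRepresentation.

(** * The vector does not vanish *)

Section Nonvanishing.
Variables (F : fieldType) (l : nat) (A : comAlgType F).
Local Notation N := (l + l)%N.
Local Notation I := (nat * nat * ('I_(l + l) * 'I_(l + l)))%type.
Variable t : I -> A.
Hypothesis t_ind : forall P : A -> Prop, P 1 ->
  (forall f g, P f -> P g -> P (f + g)) -> (forall c f, P f -> P (c *: f)) ->
  (forall i f, P f -> P (t i * f)) -> forall f, P f.
Hypothesis t_der : forall d : I -> A,
  exists D : endo A, leibniz D /\ forall i, D (t i) = d i.
Variable kappa : F.
Local Notation cder x m := (cell_der t_der x m).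
Local Notation rho := (affine_op t_der kappa).
Hypothesis char0 : forall n, n.+1%:R != 0 :> F.

(** The shift by t^(-1) leads out of the block from t^0 to t^(-1), so only the
    constant term of the vector field survives there. *)
Lemma cell_der_corner (x : 'M[F]_N) a b :
  cder x (-1) (t (0, 0, (a, b))%N) = (x a b)%:A.
Proof.
rewrite cell_der_gen /cell_field sumr_nat_eq0 => [|r _].
  rewrite (_ : Negz 0 - -1 = 0 :> int) // subr0 graph_proj_ge0 // eqxx mulmx1.
  by rewrite mxE.
by rewrite (@graph_proj_ge0 _ _ _ _ (r%:Z - -1)) ?ifF ?mulmx0 //; lia.
Qed.

Lemma affine_op_mode (x : so F l) f :
  rho (mode x (-1)) f = cder (so_val x) (-1) f.
Proof.
have E : rho (mode x (-1)) f = malg_sum (fun m (x : so F l) => cell_op t_der kappa m (so_val x))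
   << x *g -1 >> f + (2 * kappa * 0) *: f by [].
rewrite E mulr0 scale0r addr0 malg_sumU.
  by rewrite cell_opE /= scaler0 mul0r addr0.
by move=> m u v; have := cell_opP t_ind t_der kappa m 1 (so_val u) (so_val v); rewrite !scale1r.
Qed.

Variables (i1 i2 : 'I_l).
Hypothesis i12 : (i1 < i2)%N.

Let alpha := t (0, 0, (lshift l i1, lshift l i2))%N.
Let beta := t (0, 0, (lshift l i1, rshift l i2))%N.

Lemma root_sub_corner (i : 'I_l) : (i1 < i)%N ->
  cder (root_sub F i1 i) (-1) alpha = (i == i2)%:R%:A
  /\ cder (root_sub F i1 i) (-1) beta = 0.
Proof.
move=> hi; rewrite !cell_der_corner /= !mxE !eq_shift !eqxx /= !subr0.
by rewrite scale0r eq_sym.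
Qed.

Lemma root_add_corner (i : 'I_l) : (i1 < i)%N ->
  cder (root_add F i1 i) (-1) alpha = 0
  /\ cder (root_add F i1 i) (-1) beta = (i == i2)%:R%:A.
Proof.
move=> hi; rewrite !cell_der_corner /= !mxE !eq_shift !eqxx /=.
have -> : (i1 == i) = false by apply/eqP => e; rewrite e ltnn in hi.
by rewrite /= !subr0 scale0r eq_sym.
Qed.

Hypothesis rho_lie : lie_to_assoc rho.
Let Rep := env_lift rho.

Let RepM u v : Rep (u * v) = Rep u * Rep v.
Proof. exact: (env_lift_monoid_morphism rho_lie).2. Qed.
Let Rep1 : Rep 1 = 1.
Proof. exact: (env_lift_monoid_morphism rho_lie).1. Qed.
Let RepB u v : Rep (u - v) = Rep u - Rep v.
Proof. exact: env_lift_zmod_morphism rho_lie u v. Qed.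
Let Rep0 : Rep 0 = 0.
Proof. by rewrite -(subrr 0) RepB subrr. Qed.
Let RepD u v : Rep (u + v) = Rep u + Rep v.
Proof. by rewrite -[v in LHS]opprK RepB -[- v]sub0r RepB Rep0 sub0r opprK. Qed.

Lemma singular_op_corner f : Rep (singular_op F i1) f =
  \sum_(i < l | (i1 < i)%N)
    cder (root_add F i1 i) (-1) (cder (root_sub F i1 i) (-1) f).
Proof.
rewrite /singular_op.
elim/big_ind2: _ => [|u1 w1 u2 w2 <- <-|i _]; first by rewrite Rep0.
  by rewrite RepD.
by rewrite RepM endoM /Rep !(env_lift_in rho_lie) !affine_op_mode.
Qed.

(** With alpha and beta the coordinates at (1, 2) and (1, 2'), the operator
    restricts to the product of the two partial derivatives. *)
Lemma singular_op_monomial s : Rep (singular_op F i1) (alpha ^+ s.+1 * beta ^+ s.+1)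
  = (s.+1%:R ^+ 2 : F) *: (alpha ^+ s * beta ^+ s).
Proof.
have L x : leibniz (cder x (-1)) by exact: cell_der_leibniz.
have inner (i : 'I_l) : (i1 < i)%N ->
    cder (root_sub F i1 i) (-1) (alpha ^+ s.+1 * beta ^+ s.+1)
      = (i == i2)%:R *: (alpha ^+ s * beta ^+ s.+1) *+ s.+1.
  move=> hi; have [sa sb] := root_sub_corner hi.
  by rewrite L !leibnizX // sa sb !mulr0 mul0rn mulr0 addr0 mulr_algr mulrnAl -scalerAl.
rewrite singular_op_corner (bigD1 i2) //= big1 ?addr0 => [|i /andP[hi ne]].
  have [aa ab] := root_add_corner i12.
  have {}ab : cder (root_add F i1 i2) (-1) beta = 1 by rewrite ab eqxx scale1r.
  have -> : cder (root_sub F i1 i2) (-1) (alpha ^+ s.+1 * beta ^+ s.+1)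
      = (alpha ^+ s * beta ^+ s.+1) *+ s.+1 by rewrite inner // eqxx scale1r.
  rewrite (raddfMn (cder (root_add F i1 i2) (-1))) /= L leibnizX // ab mulr1.
  have -> : cder (root_add F i1 i2) (-1) (alpha ^+ s) = 0.
    case: (s) => [|s']; first by rewrite expr0 leibniz1.
    by rewrite leibnizX // aa mulr0 mul0rn.
  by rewrite mul0r add0r mulrnAr -mulrnA expr2 -natrM scaler_nat.
by rewrite (inner i hi) (negPf ne) scale0r mul0rn raddf0.
Qed.

Lemma singular_op_power n : exists2 c : F, c != 0 &
  Rep (singular_op F i1 ^+ n) (alpha ^+ n * beta ^+ n) = c%:A.
Proof.
elim: n => [|n [c c0 hc]].
  by exists 1; rewrite ?oner_neq0 // !expr0 mulr1 Rep1 scale1r.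
exists (n.+1%:R ^+ 2 * c); first by rewrite mulf_neq0 ?expf_neq0.
by rewrite exprS RepM endoM singular_op_monomial linearZ /= hc scalerA.
Qed.
End Nonvanishing.

Lemma singular_op_power_neq0 (F : fieldType) (l : nat) (k : F) (i1 i2 : 'I_l) n :
    (forall n, n.+1%:R != 0 :> F) -> (i1 < i2)%N ->
  singular_op F i1 ^+ n *: vacuum l k <> 0.
Proof.
move=> char0 i12; have two_neq0 : 2 != 0 :> F by exact: char0.
pose I := (nat * nat * ('I_(l + l) * 'I_(l + l)))%type.
pose A := {malg F[{cmonom I}]}.
have t_der (d : I -> A) : exists D : endo A, leibniz D /\ forall i, D (@pvar F I i) = d i.
  have [D [Dlin DM Dv]] := der_exists d.
  have Dl : D \in @endo_pred F A by exact/asboolP.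
  by exists (Endo Dl).
have t_ind := @pvar_ind F I.
have rho_lie := affine_op_lie_to_assoc t_ind t_der (k / 2) two_neq0.
have [c c0 hc] := singular_op_power t_ind char0 i12 rho_lie n.
(* The value at the base point of the cell. *)
pose e0 : {rmorphism A -> F} := mcoeff (mone : {cmonom I}).
have e0Z (a : F) f : e0 (a *: f) = a * e0 f by exact: mcoeffZ.
have e0t i : e0 (@pvar F I i) = 0 by rewrite /= /pvar mcoeffU cm1_eq1.
have e0_nonneg (u : nonneg F l) f :
    e0 (affine_op t_der (k / 2) (nonneg_val u) f) = k * (nonneg_val u).2 * e0 f.
  rewrite (eval0_affine_op t_ind t_der (k / 2) two_neq0 e0Z e0t).
  by rewrite [2 * _]mulrC divfK.
move: c0; rewrite -[c]mulr1 -(rmorph1 e0) -e0Z -hc.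
exact: (vacuum_functional_neq0 (rmorphD e0) e0Z rho_lie e0_nonneg).
Qed.

(** * Root vectors of the abelian nilradical *)

Section MatrixFacts.
Variables (F : fieldType) (l : nat).
Local Notation N := (l + l)%N.
Local Notation g := (so F l).

Definition star (c : 'I_N) : 'I_N :=
  match fintype.split c with inl i => rshift l i | inr i => lshift l i end.

Lemma star_lshift i : star (lshift l i) = rshift l i.
Proof. by rewrite /star (unsplitK (inl i)). Qed.
Lemma star_rshift i : star (rshift l i) = lshift l i.
Proof. by rewrite /star (unsplitK (inr i)). Qed.
Lemma starK : involutive star.
Proof.
by move=> c; case: (split_ordP c) => i ->; rewrite ?(star_lshift, star_rshift).
Qed.
Lemma star_eq a b : (star a == star b) = (a == b).
Proof. exact: (inj_eq (inv_inj starK)). Qed.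
Lemma star_neq a : (star a == a) = false.
Proof.
by case: (split_ordP a) => i ->; rewrite ?(star_lshift, star_rshift) eq_shift.
Qed.

Lemma soJE a b : soJ F l a b = (b == star a)%:R.
Proof.
rewrite /soJ; case: (split_ordP a) => i ->; case: (split_ordP b) => j ->;
  rewrite (block_mxEul, block_mxEur, block_mxEdl, block_mxEdr) !mxE;
  by rewrite ?(star_lshift, star_rshift) eq_shift // eq_sym.
Qed.

(** The entry (a', b) of the equation X^T J + J X = 0. *)
Lemma so_antisym (x : g) a b : so_val x (star b) (star a) = - so_val x a b.
Proof.
have /eqP/matrixP/(_ (star a) b) := so_valP x.
rewrite !mxE (bigD1 (star b)) //= big1 ?addr0 => [|c cb]; last first.
  by rewrite soJE (_ : (b == star c) = false) ?mulr0 // -{1}[b]starK star_eq eq_sym (negPf cb).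
rewrite (bigD1 a) //= big1 ?addr0 => [|c cb]; last first.
  by rewrite soJE starK (negPf cb) mul0r.
rewrite !soJE !starK !eqxx mxE mulr1 mul1r => /eqP.
by rewrite addr_eq0 => /eqP.
Qed.

Lemma mul_delta_entry (X : 'M[F]_N) (a b p q : 'I_N) :
  (X *m delta_mx a b) p q = X p a * (q == b)%:R.
Proof.
rewrite !mxE (bigD1 a) //= big1 ?addr0 => [|c ca]; rewrite mxE ?eqxx //.
by rewrite (negPf ca) mulr0.
Qed.

Lemma delta_mul_entry (X : 'M[F]_N) (a b p q : 'I_N) :
  (delta_mx a b *m X) p q = (p == a)%:R * X b q.
Proof.
rewrite !mxE (bigD1 b) //= big1 ?addr0 => [|c ca]; rewrite mxE ?eqxx ?andbT //.
by rewrite (negPf ca) andbF mul0r.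
Qed.

Variable i1 : 'I_l.
Local Notation o := (lshift l i1).

(** The matrix E_(o,c) - E_(c',o') for any coordinate c, so that sums over the
    two families of root vectors become one sum over coordinates. *)
Definition top_root (c : 'I_N) : g :=
  match fintype.split c with inl i => root_sub F i1 i | inr i => root_add F i1 i end.
Local Notation w := top_root.

Lemma top_root_lshift i : w (lshift l i) = root_sub F i1 i.
Proof. by rewrite /w (unsplitK (inl i)). Qed.
Lemma top_root_rshift i : w (rshift l i) = root_add F i1 i.
Proof. by rewrite /w (unsplitK (inr i)). Qed.

Lemma top_rootE c :
  so_val (w c) = delta_mx o c - delta_mx (star c) (star o).
Proof.
case: (split_ordP c) => i ->; rewrite ?(top_root_lshift, top_root_rshift) /=.
  by rewrite !star_lshift.
by rewrite star_rshift star_lshift.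
Qed.

Lemma lie_top_rootE (x : g) c p q :
  so_val (lie x (w c)) p q =
    so_val x p o * (q == c)%:R - so_val x p (star c) * (q == star o)%:R
    - ((p == o)%:R * so_val x c q - (p == star c)%:R * so_val x (star o) q).
Proof.
rewrite -[so_val (lie x (w c))]/(so_val x *m so_val (w c) - so_val (w c) *m so_val x).
rewrite top_rootE mulmxBr mulmxBl.
have mxB (X Y : 'M[F]_N) : (X - Y) p q = X p q - Y p q by rewrite !mxE.
by rewrite !mxB !mul_delta_entry !delta_mul_entry.
Qed.

Definition mid : {set 'I_N} := [set c | (c != o) && (c != star o)].

Lemma mid_star c : (star c \in mid) = (c \in mid).
Proof. by rewrite !inE -{1}[o]starK !star_eq andbC. Qed.

Lemma card_mid : #|mid| = (l + l - 2)%N.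
Proof.
have -> : mid = ~: [set o; star o].
  by apply/setP => c; rewrite !inE negb_or.
by rewrite cardsCs setCK cards2 eq_sym star_neq card_ord.
Qed.

Hypothesis two_neq0 : 2 != 0 :> F.

Lemma form_top_root (x : g) c : so_form x (w c) = so_val x c o.
Proof.
rewrite /so_form top_rootE mulmxBr raddfB /=.
have tr (X : 'M[F]_N) a b : \tr (X *m delta_mx a b) = X b a.
  rewrite /mxtrace (bigD1 b) //= big1 ?addr0 => [|p pb]; rewrite mul_delta_entry.
    by rewrite eqxx mulr1.
  by rewrite (negPf pb) mulr0.
by rewrite !tr so_antisym opprK; field.
Qed.

Lemma so_entry0 (x : g) a : so_val x (star a) a = 0.
Proof.
have := so_antisym x (star a) a; rewrite starK => /eqP; rewrite -addr_eq0.
by rewrite -mulr2n -mulr_natl mulf_eq0 (negPf two_neq0) => /eqP.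
Qed.

Definition parabolic (z : g) := forall a, a != o -> so_val z a o = 0.

Lemma top_root_entry c p q : so_val (w c) p q =
  (p == o)%:R * (q == c)%:R - (p == star c)%:R * (q == star o)%:R.
Proof. by rewrite top_rootE !mxE -!natrM !mulnb. Qed.

Lemma sum_top_rootE (f : 'I_N -> F) p q :
  (\sum_(b in mid) f b *: so_val (w b)) p q =
    (p == o)%:R * (q \in mid)%:R * f q
      - (q == star o)%:R * (p \in mid)%:R * f (star p).
Proof.
rewrite summxE.
rewrite (eq_bigr (fun b => (p == o)%:R * ((q == b)%:R * f b)
   - (q == star o)%:R * ((star p == b)%:R * f b))); last first.
  move=> b _; rewrite mxE top_root_entry -[p == star b]star_eq starK; ring.
rewrite sumrB -!mulr_sumr -!mulrA.
have pick a : \sum_(b in mid) (a == b)%:R * f b = (a \in mid)%:R * f a.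
  have [am|am] := boolP (a \in mid).
    rewrite (bigD1 a) //= eqxx big1 ?addr0 // => b /andP[_ /negPf ba].
    by rewrite eq_sym ba mul0r.
  rewrite big1 ?mul0r // => b bm; case: eqVneq => [e|_]; last by rewrite mul0r.
  by rewrite e bm in am.
by rewrite !pick mid_star.
Qed.

(** The nilradical is the vector representation of the Levi factor, twisted by
    the character z_(o,o). *)
Lemma lie_top_root_parabolic (z : g) c : parabolic z -> c \in mid ->
  lie z (w c) = so_val z o o *: w c - \sum_(b in mid) so_val z c b *: w b.
Proof.
move=> hz hc; apply: val_inj; apply/matrixP => p q.
rewrite lie_top_rootE.
have -> : val (so_val z o o *: w c - \sum_(b in mid) so_val z c b *: w b)
   = so_val z o o *: so_val (w c) - \sum_(b in mid) so_val z c b *: so_val (w b).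
  by rewrite raddfB raddf_sum.
have mxB (X Y : 'M[F]_N) : (X - Y) p q = X p q - Y p q by rewrite !mxE.
have mxZ a (X : 'M[F]_N) : (a *: X) p q = a * X p q by rewrite !mxE.
rewrite [in RHS]mxB [in RHS]mxZ sum_top_rootE top_root_entry.
have zo a : so_val z a o = (a == o)%:R * so_val z o o.
  by case: eqVneq => [->|/hz ->]; rewrite ?mul1r ?mul0r.
have -> : so_val z p (star c) = - so_val z c (star p).
  by rewrite -[in RHS](starK c) so_antisym opprK.
have -> : so_val z (star o) q = - ((q == star o)%:R * so_val z o o).
  by rewrite -{1}[q]starK so_antisym zo -{1}[o]starK star_eq.
have co : so_val z c o = 0.
  by rewrite zo; move: hc; rewrite inE => /andP[/negPf -> _]; rewrite mul0r.
rewrite zo.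
suff : (q == star o)%:R * so_val z c (star p) - (p == o)%:R * so_val z c q =
    (q == star o)%:R * (p \in mid)%:R * so_val z c (star p)
      - (p == o)%:R * (q \in mid)%:R * so_val z c q.
  move=> E; transitivity
    (so_val z o o * ((p == o)%:R * (q == c)%:R - (p == star c)%:R * (q == star o)%:R)
      + ((q == star o)%:R * so_val z c (star p) - (p == o)%:R * so_val z c q)).
    by ring.
  by rewrite E; ring.
rewrite !inE; have [->|po] := eqVneq p o.
  rewrite !mul1r mulr0 mul0r sub0r; have [->|qo] := eqVneq q o.
    by rewrite co /= !mul0r eq_sym star_neq mul0r subrr oppr0.
  by have [->|_] := eqVneq q (star o); rewrite /= ?mul1r ?mul0r ?subrr ?sub0r ?oppr0.
have [->|_] := eqVneq p (star o); last by rewrite !mul0r mulr1.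
by rewrite starK co !mulr0 !mul0r.
Qed.
Lemma midP c : c \in mid -> (c == o) = false /\ (c == star o) = false.
Proof. by rewrite inE => /andP[/negPf -> /negPf ->]. Qed.

Lemma top_root_parabolic b : b \in mid -> parabolic (w b).
Proof.
move=> /midP[bo _] a ao; rewrite top_root_entry (negPf ao) mul0r.
by rewrite -[o == star o]/(o == star o) [o == star o]eq_sym star_neq mulr0 subrr.
Qed.

Lemma lie_top_root_top_root b c : b \in mid -> c \in mid -> lie (w b) (w c) = 0.
Proof.
move=> hb hc; rewrite (lie_top_root_parabolic (top_root_parabolic hb) hc).
have [bo bs] := midP hb; have [co cs] := midP hc.
rewrite top_root_entry eqxx [o == b]eq_sym bo [o == star o]eq_sym star_neq.
rewrite !mulr0 subrr scale0r sub0r big1 ?oppr0 // => d /midP[_ ds].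
by rewrite top_root_entry co ds !mul0r mulr0 subrr scale0r.
Qed.

Lemma lie_top_root_is_parabolic (x : g) c : c \in mid -> parabolic (lie x (w c)).
Proof.
move=> /midP[co cs] a ao; rewrite lie_top_rootE so_entry0 (negPf ao).
by rewrite [o == c]eq_sym co [o == star o]eq_sym star_neq !mulr0 !mul0r !subrr.
Qed.

Lemma lie_top_root_diag (x : g) c : c \in mid ->
  so_val (lie x (w c)) o o = - so_val x c o.
Proof.
move=> /midP[co cs]; rewrite lie_top_rootE so_entry0 eqxx.
by rewrite [o == c]eq_sym co [o == star o]eq_sym star_neq !mulr0 mul1r !subr0 sub0r.
Qed.

Lemma form_lie_top_root (x : g) c : c \in mid -> so_form (lie x (w c)) (w (star c)) = 0.
Proof.
move=> hc; rewrite form_top_root; apply: lie_top_root_is_parabolic => //.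
by have := hc; rewrite -mid_star => /midP[-> _].
Qed.

(** The Casimir of so(2l-2) on its vector representation: each of the 2l - 2
    values of c contributes one copy of the sum on the right, and the weights
    of the brackets [x, w_c] together with the terms b = c take away two. *)
Lemma top_root_casimir (x : g) :
  \sum_(c in mid) lie (lie x (w c)) (w (star c)) =
    (l%:R - 2) * 2 *: \sum_(c in mid) so_val x c o *: w (star c).
Proof.
pose P := \sum_(c in mid) so_val x c o *: w (star c).
have star_sum (V : zmodType) (f : 'I_N -> V) :
    \sum_(c in mid) f (star c) = \sum_(c in mid) f c.
  rewrite [RHS](reindex_inj (inv_inj starK)) /=.
  by apply: eq_bigl => c; rewrite mid_star.
(* The sum over b in [lie_top_root_parabolic] splits into the term b = c and
   a sum that does not depend on c. *)
have step c : c \in mid -> lie (lie x (w c)) (w (star c)) =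
    - (so_val x c o *: w (star c)) - so_val x (star c) o *: w c + P.
  move=> hc; have hsc : star c \in mid by rewrite mid_star.
  rewrite (lie_top_root_parabolic (lie_top_root_is_parabolic x hc) hsc).
  rewrite lie_top_root_diag // scaleNr -addrA; congr (_ + _).
  rewrite (eq_bigr (fun b => (b == c)%:R * so_val x (star c) o *: w b
      - so_val x (star b) o *: w b)); last first.
    move=> b hb; have [bo bs] := midP hb; have [co cs] := midP hc.
    rewrite lie_top_rootE bs.
    have -> : (star c == o) = false by rewrite -[o]starK star_eq.
    have -> : so_val x (star o) b = - so_val x (star b) o.
      by rewrite -{1}[b]starK so_antisym.
    by rewrite eqxx mulr1n mulr0n -scalerBl; congr (_ *: _); ring.
  rewrite sumrB opprB [RHS]addrC; congr (_ - _).
    by rewrite /P -star_sum; apply: eq_bigr => b _; rewrite starK.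
  rewrite (bigD1 c) //= eqxx mul1r big1 ?addr0 // => b /andP[_ /negPf ->].
  by rewrite mul0r scale0r.
rewrite (eq_bigr _ step) big_split sumrB /= sumrN sumr_const card_mid.
have -> : \sum_(c in mid) so_val x (star c) o *: w c = P.
  by rewrite /P -star_sum; apply: eq_bigr => c _; rewrite starK.
rewrite -/P -scaler_nat -scaleN1r -!scalerDl natrB ?natrD.
  by congr (_ *: _); ring.
by case: (l) i1 => [[]|l' _] //; lia.
Qed.
End MatrixFacts.

(** * Currents acting on powers of the quadratic form *)

(** Only the commutation relations of the currents are used, so the algebra and
    its module are kept abstract. *)
Section CurrentRelations.
Variables (F : fieldType) (l : nat) (U : algType F).
Local Notation N := (l + l)%N.
Local Notation g := (so F l).
Hypothesis two_neq0 : 2 != 0 :> F.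
Variables (cur : g -> int -> U) (K : U).
Hypothesis curP : forall a x y m, cur (a *: x + y) m = a *: cur x m + cur y m.
Hypothesis cur_comm : forall x y m r, cur x m * cur y r =
  cur y r * cur x m + cur (lie x y) (m + r) + (m%:~R * (m + r == 0)%:R * so_form x y) *: K.
Hypothesis central_comm : forall x m, K * cur x m = cur x m * K.
Variable i1 : 'I_l.
Local Notation o := (lshift l i1).
Local Notation mid := (mid i1).
Local Notation W c r := (cur (top_root F i1 c) r).

Let cur0 m : cur 0 m = 0.
Proof.
by have := curP (-1) 0 0 m; rewrite scaler0 addr0 scaleN1r addNr.
Qed.
Let curD x y m : cur (x + y) m = cur x m + cur y m.
Proof. by have := curP 1 x y m; rewrite !scale1r. Qed.
Let curZ a x m : cur (a *: x) m = a *: cur x m.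
Proof. by have := curP a x 0 m; rewrite !addr0 cur0 addr0. Qed.
Let cur_sum (P : pred 'I_N) (f : 'I_N -> g) m :
  cur (\sum_(c | P c) f c) m = \sum_(c | P c) cur (f c) m.
Proof. by elim/big_ind2: _ => [|u v u' v' <- <-|//]; rewrite ?cur0 ?curD. Qed.

(** Twice the operator of the theorem: the sum runs over both members of each
    pair (c, c'), which makes it visibly invariant under the exchange. *)
Definition quad : U := \sum_(c in mid) W c (-1) * W (star c) (-1).

Lemma top_current_comm b c m r : b \in mid -> c \in mid -> W b m * W c r = W c r * W b m.
Proof.
move=> hb hc; rewrite cur_comm lie_top_root_top_root // cur0 form_top_root //.
rewrite (top_root_parabolic F hb) ?mulr0 ?scale0r ?addr0 //.
by have [-> _] := midP hc.
Qed.

Let star_sum (V : zmodType) (f : 'I_N -> V) :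
  \sum_(c in mid) f (star c) = \sum_(c in mid) f c.
Proof.
rewrite [RHS](reindex_inj (inv_inj (@starK l))) /=.
by apply: eq_bigl => c; rewrite mid_star.
Qed.

Lemma top_current_quad c m : c \in mid -> W c m * quad = quad * W c m.
Proof.
move=> hc; rewrite /quad mulr_sumr mulr_suml; apply: eq_bigr => b hb.
have hsb : star b \in mid by rewrite mid_star.
by rewrite mulrA top_current_comm // -mulrA [W c m * W (star b) _]top_current_comm // mulrA.
Qed.

Lemma central_quad : K * quad = quad * K.
Proof.
rewrite /quad mulr_sumr mulr_suml; apply: eq_bigr => b hb.
by rewrite mulrA central_comm -mulrA central_comm mulrA.
Qed.

Lemma current_quad x r : cur x r * quad = quad * cur x r
  + (\sum_(c in mid) (cur (lie x (top_root F i1 c)) (r - 1) * W (star c) (-1)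
      + W c (-1) * cur (lie x (top_root F i1 (star c))) (r - 1)))
  + (r%:~R * (r - 1 == 0)%:R * 2) *: \sum_(c in mid) so_val x c o *: (W (star c) (-1) * K).
Proof.
rewrite /quad mulr_suml mulr_sumr.
rewrite (eq_bigr (fun c => W c (-1) * W (star c) (-1) * cur x r
  + (cur (lie x (top_root F i1 c)) (r - 1) * W (star c) (-1)
      + W c (-1) * cur (lie x (top_root F i1 (star c))) (r - 1))
  + (r%:~R * (r - 1 == 0)%:R) *: (so_val x c o *: (W (star c) (-1) * K)
       + so_val x (star c) o *: (W c (-1) * K)))); last first.
  move=> c _; rewrite mulrA cur_comm !mulrDl -[W c (-1) * cur x r * _]mulrA cur_comm.
  rewrite !mulrDr mulrA -!scalerAl -!scalerAr central_comm !form_top_root //.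
  rewrite scalerDr !scalerA -!addrA; congr (_ + _).
  by rewrite [RHS]addrCA; congr (_ + _); rewrite addrC -addrA.
rewrite !big_split /= -scaler_sumr big_split /=; congr (_ + _ + _).
have -> : \sum_(c in mid) so_val x (star c) o *: (W c (-1) * K)
    = \sum_(c in mid) so_val x c o *: (W (star c) (-1) * K).
  by rewrite -star_sum; apply: eq_bigr => c _; rewrite starK.
by rewrite -mulr2n -scaler_nat scalerA.
Qed.

Variables (V : lmodType U) (v0 : V) (k : F).
Hypothesis cur_v0 : forall x m, 0 <= m -> cur x m *: v0 = 0.
Hypothesis central_v0 : K *: v0 = k%:A *: v0.
Local Notation v s := (quad ^+ s *: v0).

Lemma scale_algA (u : U) (a : F) (x : V) : u *: (a%:A *: x) = a%:A *: (u *: x).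
Proof. by rewrite !scalerA mulr_algl mulr_algr. Qed.

Lemma scale_algl (a : F) (u : U) (x : V) : (a *: u) *: x = a%:A *: (u *: x).
Proof. by rewrite scalerA mulr_algl. Qed.

Lemma alg_scaleA (a b : F) (x : V) : a%:A *: (b%:A *: x) = (a * b)%:A *: x.
Proof. by rewrite scalerA mulr_algl scalerA. Qed.

Let vS s : v s.+1 = quad *: v s.
Proof. by rewrite exprS scalerA. Qed.

Lemma central_power s : K *: v s = k%:A *: v s.
Proof.
elim: s => [|s IH]; first by rewrite scale1r.
by rewrite vS scalerA central_quad -scalerA IH scale_algA.
Qed.

Lemma top_current_power c m s : c \in mid -> 0 <= m -> W c m *: v s = 0.
Proof.
move=> hc hm; elim: s => [|s IH]; first by rewrite scale1r cur_v0.
by rewrite vS scalerA top_current_quad // -scalerA IH scaler0.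
Qed.

Lemma current_lie_parabolic z c m : parabolic i1 z -> c \in mid ->
  cur (lie z (top_root F i1 c)) m
    = so_val z o o *: W c m - \sum_(b in mid) so_val z c b *: W b m.
Proof.
move=> hz hc; rewrite lie_top_root_parabolic // curD curZ -scaleN1r curZ cur_sum.
by rewrite scaleN1r; congr (_ - _); apply: eq_bigr => b _; rewrite curZ.
Qed.

Lemma quad_parabolic z r : parabolic i1 z -> cur z r * quad = quad * cur z r
  + 2 *: \sum_(c in mid) W (star c) (-1) * cur (lie z (top_root F i1 c)) (r - 1).
Proof.
move=> hz; rewrite current_quad [X in _ + _ *: X]big1 ?scaler0 ?addr0 => [|c /midP[co _]]; last first.
  by rewrite hz ?co // scale0r.
congr (_ + _); rewrite big_split /= -[X in _ + X]star_sum.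
rewrite scaler_nat mulr2n; congr (_ + _); apply: eq_bigr => c hc; last by rewrite starK.
have hs : star c \in mid by rewrite mid_star.
rewrite current_lie_parabolic // mulrBl mulrBr mulr_suml mulr_sumr.
rewrite -scalerAl -scalerAr top_current_comm //; congr (_ - _); apply: eq_bigr => b hb.
by rewrite -scalerAl -scalerAr top_current_comm.
Qed.

Lemma parabolic_power_pos z r s : parabolic i1 z -> 1 <= r -> cur z r *: v s = 0.
Proof.
move=> hz hr; elim: s => [|s IH]; first by rewrite scale1r cur_v0 //; lia.
rewrite vS scalerA quad_parabolic // scalerDl -scalerA IH scaler0 add0r.
rewrite scale_algl scaler_suml big1 ?scaler0 // => c hc.
rewrite current_lie_parabolic // -scalerA scalerBl scale_algl top_current_power //; last by lia.
rewrite scaler0 sub0r scaler_suml big1 ?oppr0 ?scaler0 // => b hb.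
by rewrite scale_algl top_current_power ?scaler0 //; lia.
Qed.

(** Invariance of the form under so(2l-2): the matrix of z is antisymmetric for
    the pairing c <-> c', while the product of two commuting currents is
    symmetric. *)
Lemma quad_parabolic0 z : parabolic i1 z ->
  cur z 0 * quad = quad * cur z 0 + (2 * so_val z o o) *: quad.
Proof.
move=> hz; rewrite quad_parabolic // sub0r -scalerA; congr (_ + _ *: _).
rewrite (eq_bigr (fun c => so_val z o o *: (W c (-1) * W (star c) (-1))
   - \sum_(b in mid) so_val z c b *: (W (star c) (-1) * W b (-1)))); last first.
  move=> c hc; have hs : star c \in mid by rewrite mid_star.
  rewrite current_lie_parabolic // mulrBr -scalerAr top_current_comm // mulr_sumr.
  by congr (_ - _); apply: eq_bigr => b _; rewrite scalerAr.
rewrite sumrB -scaler_sumr -/quad.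
set S := \sum_(_ in _) \sum_(_ in _) _.
suff -> : S = 0 by rewrite subr0.
have : S = - S.
  rewrite {1}/S exchange_big /= -star_sum /S -sumrN; apply: eq_bigr => c hc; rewrite -star_sum -sumrN.
  apply: eq_bigr => b hb; rewrite starK so_antisym scaleNr top_current_comm ?mid_star //.
move/eqP; rewrite -addr_eq0 -mulr2n -scaler_nat scaler_eq0.
by rewrite (negPf two_neq0) => /eqP.
Qed.

Lemma parabolic_power0 z s : parabolic i1 z ->
  cur z 0 *: v s = ((2 * so_val z o o) *+ s)%:A *: v s.
Proof.
move=> hz; elim: s => [|s IH].
  by rewrite !scale1r cur_v0 // mulr0n scale0r scale0r.
rewrite vS scalerA quad_parabolic0 // scalerDl -scalerA IH.
rewrite scale_algA (scale_algl _ quad) -scalerDl -scalerDl.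
by rewrite -mulrSr.
Qed.

(** The element of the nilradical dual to x: the coefficient x_(c,o) is the form
    of x and w_c. *)
Definition dual_top (x : g) m : U := \sum_(c in mid) so_val x c o *: W (star c) m.

Lemma dual_top_quad x m s : dual_top x m *: (quad *: v s) = quad *: (dual_top x m *: v s).
Proof.
rewrite scalerA [RHS]scalerA; congr (_ *: _).
rewrite /dual_top mulr_suml mulr_sumr; apply: eq_bigr => c hc; have hs : star c \in mid by rewrite mid_star.
by rewrite -scalerAl -scalerAr top_current_quad.
Qed.

Lemma dual_top_power_ge0 x m s : 0 <= m -> dual_top x m *: v s = 0.
Proof.
move=> hm; rewrite /dual_top scaler_suml big1 // => c hc.
by rewrite scale_algl top_current_power ?mid_star ?scaler0.
Qed.

Lemma casimir_dual_top x m :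
  \sum_(c in mid) cur (lie (lie x (top_root F i1 c)) (top_root F i1 (star c))) m
    = ((l%:R - 2) * 2) *: dual_top x m.
Proof.
rewrite -cur_sum top_root_casimir // curZ cur_sum.
by congr (_ *: _); apply: eq_bigr => c _; rewrite curZ.
Qed.

(** Moving x(r) across one factor: a Casimir term, a term in which the bracket
    acts on the remaining factors, and a level term. *)
Lemma current_quad_power x r s : cur x r *: (quad *: v s) = quad *: (cur x r *: v s)
  + ((l%:R - 2) * 2)%:A *: (dual_top x (r - 2) *: v s)
  + 2%:A *: (\sum_(c in mid) W (star c) (-1) *: (cur (lie x (top_root F i1 c)) (r - 1) *: v s))
  + (r%:~R * (r - 1 == 0)%:R * 2 * k)%:A *: (dual_top x (-1) *: v s).
Proof.
rewrite [LHS]scalerA current_quad 2![in LHS]scalerDl -!addrA; congr (_ + _); first by rewrite -scalerA.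
have -> : \sum_(c in mid) (cur (lie x (top_root F i1 c)) (r - 1) * W (star c) (-1) +
     W c (-1) * cur (lie x (top_root F i1 (star c))) (r - 1))
  = \sum_(c in mid) cur (lie (lie x (top_root F i1 c)) (top_root F i1 (star c))) (r - 2)
   + 2 *: \sum_(c in mid) W (star c) (-1) * cur (lie x (top_root F i1 c)) (r - 1).
  rewrite big_split /= scaler_nat mulr2n addrA; congr (_ + _); last first.
    by rewrite -star_sum; apply: eq_bigr => c _; rewrite starK.
  rewrite -big_split; apply: eq_bigr => c hc /=.
  rewrite cur_comm form_lie_top_root // mulr0 scale0r addr0 [LHS]addrC.
  by rewrite (_ : r - 2 = r - 1 + -1) //; lia.
rewrite casimir_dual_top [in LHS]scalerDl -addrA; congr (_ + (_ + _)).
- by rewrite (scale_algl _ (dual_top _ _)).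
- rewrite [LHS]scale_algl; congr (_ *: _); rewrite scaler_suml.
  by apply: eq_bigr => c _; rewrite -scalerA.
rewrite [LHS]scale_algl; have -> : forall a (u : V), (a * k)%:A *: u = a%:A *: (k%:A *: u).
  by move=> a u; rewrite scalerA mulr_algl scalerA.
congr (_ *: _); rewrite !scaler_suml scaler_sumr; apply: eq_bigr => c _.
rewrite [LHS]scale_algl -scalerA central_power scale_algA scale_algA.
by congr (_ *: _); rewrite [RHS]scale_algl.
Qed.

Lemma current_power_ge2 x r s : 2 <= r -> cur x r *: v s = 0.
Proof.
move=> hr; elim: s => [|s IH]; first by rewrite scale1r cur_v0 //; lia.
rewrite vS current_quad_power IH scaler0 add0r dual_top_power_ge0; last by lia.
rewrite scaler0 add0r big1 ?scaler0 ?add0r => [|c hc]; last first.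
  by rewrite parabolic_power_pos ?scaler0 //; [exact: lie_top_root_is_parabolic | lia].
by rewrite (_ : (r - 1 == 0) = false) ?mulr0 ?mul0r ?scale0r //; lia.
Qed.

(** The Casimir, weight and level terms of [current_quad_power] are now
    proportional; summing over the positions of the factor crossed gives a
    quadratic polynomial in the number of factors. *)
Lemma current_power1 x s : cur x 1 *: v s.+1
   = (2 * (k + l%:R - 1 - s.+1%:R) *+ s.+1)%:A *: (dual_top x (-1) *: v s).
Proof.
(* One factor crossed; the other s' factors have total weight 2 s'. *)
have step s' : cur x 1 *: v s'.+1 = quad *: (cur x 1 *: v s')
    + (2 * (k + l%:R - 2 - 2 * s'%:R))%:A *: (dual_top x (-1) *: v s').
  rewrite vS current_quad_power -!addrA; congr (_ + _).
  rewrite subrr (_ : 1 - 2 = -1 :> int) //.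
  rewrite (eq_bigr (fun c => (- (2 * s'%:R))%:A *: ((so_val x c o *: W (star c) (-1)) *: v s'))); last first.
    move=> c hc; rewrite parabolic_power0; last exact: lie_top_root_is_parabolic.
    rewrite lie_top_root_diag // scale_algA (scale_algl _ (W _ _)).
    rewrite alg_scaleA; congr ((_ *: _) *: _).
    by rewrite -mulr_natr; ring.
  rewrite -scaler_sumr -scaler_suml -/(dual_top x (-1)).
  rewrite alg_scaleA -!scalerDl; congr ((_ *: _) *: _).
  by rewrite eqxx mulr1z mulr1n; ring.
elim: s => [|s IH].
  rewrite step scale1r cur_v0 // scaler0 add0r; congr (_ *: _).
  by congr (_ *: _); ring.
rewrite step IH scale_algA -dual_top_quad -vS -scalerDl -scalerDl.
by congr ((_ *: _) *: _); rewrite -[X in X + _]mulr_natr -[RHS]mulr_natr; ring.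
Qed.

Lemma current_power_pos x m n : (0 < n)%N -> k = n%:R - l%:R + 1 -> 1 <= m ->
  cur x m *: v n = 0.
Proof.
move=> n0 kE hm; have [->|m1] := eqVneq m 1; last by apply: current_power_ge2; lia.
case: n n0 kE => // n _ kE; rewrite current_power1.
have -> : k + l%:R - 1 - n.+1%:R = 0 by rewrite kE; ring.
by rewrite mulr0 mul0rn !scale0r.
Qed.

Lemma scale_power_half (T Q : U) (n : nat) (u : V) :
  T = 2 *: Q -> Q ^+ n *: u = (2^-1 ^+ n)%:A *: (T ^+ n *: u).
Proof.
move=> ->; rewrite exprZn (scale_algl _ (Q ^+ n)) alg_scaleA.
by rewrite -exprMn mulVf // expr1n !scale1r.
Qed.
End CurrentRelations.

(** * The vacuum module *)

Section AffineVacuum.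
Variables (F : fieldType) (l : nat).
Local Notation g := (so F l).

Lemma modeP a (x y : g) m : mode (a *: x + y) m = a *: mode x m + mode y m.
Proof.
rewrite /mode -[RHS]/(loop_scale a << x *g m >> + << y *g m >>, a * 0 + 0).
by rewrite loop_scaleU monalgUD mulr0 addr0.
Qed.

Lemma lie_mode (x y : g) m r : lie (mode x m) (mode y r) =
  (m%:~R * (m + r == 0)%:R * so_form x y) *: central F l + mode (lie x y) (m + r).
Proof.
rewrite -[LHS]/(loop_lie << x *g m >> << y *g r >>, loop_cocycle << x *g m >> << y *g r >>).
rewrite loop_lieU loop_cocycleU; set c := _ * _ * _.
rewrite -[RHS]/(loop_scale c 0 + << lie x y *g m + r >>, c * 1 + 0).
by rewrite loop_scale0 add0r mulr1 addr0.
Qed.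

Lemma lie_central (x : g) m : lie (central F l) (mode x m) = 0.
Proof.
rewrite -[LHS]/(loop_lie 0 << x *g m >>, loop_cocycle 0 << x *g m >>).
by rewrite loop_lie0l loop_cocycle0l.
Qed.

Lemma mode_envP a (x y : g) m :
  env_in (mode (a *: x + y) m) = a *: env_in (mode x m) + env_in (mode y m).
Proof. by rewrite modeP linearP. Qed.

Lemma mode_env_comm (x y : g) m r : env_in (mode x m) * env_in (mode y r) =
  env_in (mode y r) * env_in (mode x m) + env_in (mode (lie x y) (m + r))
  + (m%:~R * (m + r == 0)%:R * so_form x y) *: env_in (central F l).
Proof.
have := env_in_lie (mode x m) (mode y r); rewrite lie_mode linearP => /eqP.
rewrite eq_sym subr_eq => /eqP ->; rewrite [LHS]addrC -[RHS]addrA.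
by congr (_ + _); exact: addrC.
Qed.

Lemma central_env_comm (x : g) m :
  env_in (central F l) * env_in (mode x m) = env_in (mode x m) * env_in (central F l).
Proof.
have := env_in_lie (central F l) (mode x m); rewrite lie_central linear0 => /eqP.
by rewrite eq_sym subr_eq0 => /eqP.
Qed.

Variable k : F.

(** Both sides are images of elements of U(g[t] + CK) with the same action on
    the one-dimensional module. *)
Lemma nonneg_vacuum (u : nonneg F l) :
  env_in (nonneg_val u) *: vacuum l k = (k * (nonneg_val u).2)%:A *: vacuum l k.
Proof.
have act_vac (a : env (nonneg F l)) : nonneg_env a *: vacuum l k
    = tens (@nonneg_env F l) 1 ((env_lift (level_char k) a : F) * 1 : level_mod k).
  exact: (@scale_tens1 _ _ (@nonneg_env F l) (level_mod k) a (1 : F)).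
have -> : env_in (nonneg_val u) = nonneg_env (env_in u).
  by rewrite -(env_lift_in (@nonneg_env_lie F l)).
set c := k * _.
have -> : c%:A = nonneg_env (c%:A : env (nonneg F l)).
  transitivity (c *: @nonneg_env F l 1).
    by rewrite (rmorph1 (@nonneg_env F l)).
  exact/esym/(env_lift_scalable (@nonneg_env_lie F l) c 1).
have E : env_lift (level_char k) (env_in u)
    = env_lift (level_char k) (c%:A : env (nonneg F l)) :> F.
  rewrite (env_lift_in (@level_char_lie F l k)).
  transitivity (c * (env_lift (level_char k) (1 : env (nonneg F l)) : F)).
    by rewrite (env_lift_monoid_morphism (@level_char_lie F l k)).1 mulr1.
  exact/esym/(env_lift_scalable (@level_char_lie F l k) c 1).
pose T (b : F) := tens (@nonneg_env F l) 1 (b * 1 : level_mod k).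
exact: (etrans (act_vac _) (etrans (congr1 T E) (esym (act_vac _)))).
Qed.

Lemma mode_vacuum (x : g) m : 0 <= m -> env_in (mode x m) *: vacuum l k = 0.
Proof.
move=> hm; have hn : mode x m \in @nonneg_pred F l.
  apply/nonnegP => r hr; rewrite mcoeffU; case: eqP => // e.
  by move: hr; rewrite -e ltNge hm.
by rewrite (nonneg_vacuum (Nonneg hn)) mulr0 scale0r scale0r.
Qed.

Lemma central_vacuum : env_in (central F l) *: vacuum l k = k%:A *: vacuum l k.
Proof.
have hn : central F l \in @nonneg_pred F l.
  by apply/nonnegP => r hr; rewrite mcoeff0.
by rewrite (nonneg_vacuum (Nonneg hn)) mulr1.
Qed.
End AffineVacuum.

(** * Singularity *)

Section SingularVector.
Variables (F : fieldType) (l : nat).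
Local Notation g := (so F l).
Hypothesis char0 : forall n, n.+1%:R != 0 :> F.
Variables (i1 i2 : 'I_l).
Hypothesis i1_first : val i1 = 0%N.
Hypothesis i12 : (i1 < i2)%N.
Variable n : nat.
Local Notation o := (lshift l i1).

Let two_neq0 : 2 != 0 :> F. Proof. exact: char0. Qed.

Lemma coroot_is_diag j : root_sub F j j \in @cartan_pred F l.
Proof.
apply/is_diag_mxP => a b ab; rewrite !mxE.
have ne c : (a == c) && (b == c) = false.
  by apply/negP => /andP[/eqP ac /eqP bc]; rewrite ac bc eqxx in ab.
by rewrite !ne subrr.
Qed.

Definition coroot j : cartan F l := Cartan (coroot_is_diag j).

Lemma eps_coroot i j : eps i (coroot j) = (i == j)%:R.
Proof. by rewrite /eps /= !mxE !eq_shift /= subr0 andbb. Qed.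

Lemma lie_corootE j (x : g) a b : so_val (lie (cartan_val (coroot j)) x) a b =
  ((a == lshift l j)%:R - (a == rshift l j)%:R
    - (b == lshift l j)%:R + (b == rshift l j)%:R) * so_val x a b.
Proof.
rewrite -[so_val _]/(root_sub_mx F j j *m so_val x - so_val x *m root_sub_mx F j j).
have mxB (X Y : 'M[F]_(l + l)) : (X - Y) a b = X a b - Y a b by rewrite !mxE.
rewrite /root_sub_mx mulmxBl mulmxBr !mxB !mul_delta_entry !delta_mul_entry.
have Ea (c : 'I_(l + l)) : (a == c)%:R * so_val x c b = (a == c)%:R * so_val x a b.
  by case: eqVneq => [->|_]; rewrite ?mul0r.
have Eb (c : 'I_(l + l)) : so_val x a c * (b == c)%:R = so_val x a b * (b == c)%:R.
  by case: eqVneq => [->|_]; rewrite ?mulr0.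
by rewrite !Ea !Eb; ring.
Qed.

(** On an entry (a, o) with a <> o the eigenvalue of the first coroot differs
    from the value of the root by -1, -2 or -3; on (o, o) the eigenvalue of the
    coroot of j is 0, while the root takes the value 1 or -1.  So these entries
    vanish. *)
Lemma nplus_root_space (sgn : bool) (i j : 'I_l) (x : g) : (i < j)%N ->
    root_space (fun h => eps i h + (-1) ^+ sgn * eps j h) x ->
  parabolic i1 x /\ so_val x o o = 0.
Proof.
move=> ij hx.
have ji1 : (j == i1) = false.
  by apply/eqP => e; move: ij; rewrite e i1_first.
have ij' : (i == j) = false by apply/eqP => e; rewrite e ltnn in ij.
have entry d a b : ((a == lshift l d)%:R - (a == rshift l d)%:R
    - (b == lshift l d)%:R + (b == rshift l d)%:R) * so_val x a b
    = ((i == d)%:R + (-1) ^+ sgn * (j == d)%:R) * so_val x a b.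
  rewrite -lie_corootE (hx (coroot d)) !eps_coroot.
  by rewrite -[so_val (_ *: x)]/(_ *: so_val x) mxE.
have cancel (u v w : F) : u * w = v * w -> u - v != 0 -> w = 0.
  move=> e uv; apply/eqP; move/eqP: e; rewrite -subr_eq0 -mulrBl mulf_eq0.
  by rewrite (negPf uv).
split=> [a ao|].
  have := entry i1 a o; rewrite eqxx eq_shift (negPf ao) ji1 mulr0 !addr0 => /cancel; apply.
  set b1 := a == _; set b2 := i == i1.
  have -> : false%:R - b1%:R - true%:R - b2%:R = - (b1 + b2).+1%:R :> F.
    by rewrite -natr1 natrD mulr0n mulr1n; ring.
  by rewrite oppr_eq0 char0.
have := entry j o o; rewrite ij' eqxx mulr1 add0r => /cancel; apply.
have -> : (o == lshift l j) = false by rewrite eq_shift eq_sym.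
by rewrite eq_shift !mulr0n !subr0 addr0 sub0r oppr_eq0 signr_eq0.
Qed.

Local Notation U := (env (affine F l)).
Local Notation cur := (fun (x : g) (m : int) => env_in (mode x m) : U).

Lemma first_lt (i : 'I_l) : (i1 < i)%N = (i != i1).
Proof. by rewrite i1_first lt0n -val_eqE /= i1_first. Qed.

Section QuadFirst.
Variables (U' : algType F) (cur' : g -> int -> U') (K : U').
Hypothesis curP : forall a x y m, cur' (a *: x + y) m = a *: cur' x m + cur' y m.
Hypothesis cur_comm : forall x y m r, cur' x m * cur' y r =
  cur' y r * cur' x m + cur' (lie x y) (m + r) + (m%:~R * (m + r == 0)%:R * so_form x y) *: K.

Lemma quad_first : quad cur' i1 = 2 *:
  \sum_(i < l | (i1 < i)%N) cur' (root_sub F i1 i) (-1) * cur' (root_add F i1 i) (-1).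
Proof.
have memL i : (lshift l i \in mid i1) = (i1 < i)%N.
  by rewrite inE star_lshift !eq_shift andbT first_lt.
have memR i : (rshift l i \in mid i1) = (i1 < i)%N.
  by rewrite inE star_lshift !eq_shift /= first_lt.
rewrite /quad big_split_ord /=.
rewrite (eq_bigl _ _ memL) [X in _ + X](eq_bigl _ _ memR).
rewrite scaler_nat mulr2n; congr (_ + _); apply: eq_bigr => i hi.
  by rewrite star_lshift top_root_lshift top_root_rshift.
rewrite star_rshift (top_current_comm two_neq0 curP cur_comm) ?memL ?memR //.
by rewrite top_root_lshift top_root_rshift.
Qed.
End QuadFirst.

Lemma quad_singular_op : quad cur i1 = 2 *: singular_op F i1.
Proof. exact: (quad_first (@mode_envP F l) (@mode_env_comm F l)). Qed.

Definition sv_weight (h : cartan F l) : F^o := (2 * so_val (cartan_val h) o o) *+ n.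

Fact sv_weight_linear : linear sv_weight.
Proof.
move=> a h h'; rewrite /sv_weight -[so_val (cartan_val _)]/(a *: so_val (cartan_val h) + so_val (cartan_val h')).
by rewrite !mxE mulrDr mulrnDl [_ *: _]mulrnAr mulrCA.
Qed.
HB.instance Definition _ :=
  GRing.isLinear.Build F (cartan F l) F^o _ sv_weight sv_weight_linear.

Lemma cartan_parabolic (h : cartan F l) : parabolic i1 (cartan_val h).
Proof. by case: h => h /= /is_diag_mxP hd a ao; exact: hd. Qed.

Let k : F := n%:R - l%:R + 1.
Local Notation V := (universal_affine l k).
Local Notation vn := (quad cur i1 ^+ n *: vacuum l k).

Lemma quad_vacuum_cartan h : env_in (mode (cartan_val h) 0) *: vn = (sv_weight h)%:A *: vn.
Proof.
exact: (parabolic_power0 two_neq0 (@mode_envP F l) (@mode_env_comm F l)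
  (@central_env_comm F l) (@mode_vacuum F l k) n (cartan_parabolic h)).
Qed.

Lemma quad_vacuum_central : env_in (central F l) *: vn = k%:A *: vn.
Proof.
exact: (central_power (@central_env_comm F l) i1 (@central_vacuum F l k) n).
Qed.

Lemma quad_vacuum_parabolic z : parabolic i1 z -> so_val z o o = 0 ->
  env_in (mode z 0) *: vn = 0.
Proof.
move=> hz z0; have := parabolic_power0 two_neq0 (@mode_envP F l)
  (@mode_env_comm F l) (@central_env_comm F l) (@mode_vacuum F l k) n hz.
by rewrite z0 mulr0 mul0rn scale0r scale0r.
Qed.

Lemma quad_vacuum_pos x m : (0 < n)%N -> 1 <= m -> env_in (mode x m) *: vn = 0.
Proof.
move=> n0; apply: (current_power_pos two_neq0 (@mode_envP F l) (@mode_env_comm F l)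
    (@central_env_comm F l) i1 (@mode_vacuum F l k) (@central_vacuum F l k)) => //.
Qed.

Local Notation w := (singular_op F i1 ^+ n *: vacuum l k).

Lemma singular_op_vector : w = (2^-1 ^+ n)%:A *: vn.
Proof. exact: (scale_power_half two_neq0 n (vacuum l k) quad_singular_op). Qed.

Lemma act_singular_op u : act u w = (2^-1 ^+ n)%:A *: (env_in u *: vn).
Proof.
exact: (etrans (congr1 (act u) singular_op_vector) (scale_algA (env_in u) _ vn)).
Qed.

Lemma act_singular_op_scalar u b : env_in u *: vn = b%:A *: vn ->
  act u w = (b%:A : U) *: w.
Proof.
move=> hu; pose c : U := (2^-1 ^+ n)%:A; pose scale (a : U) (t : V) := a *: t.
exact: (etrans (act_singular_op u) (etrans (congr1 (scale c) hu)
  (etrans (scale_algA c b vn) (congr1 (scale b%:A) (esym singular_op_vector))))).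
Qed.

Lemma act_singular_op0 u : env_in u *: vn = 0 -> act u w = 0.
Proof.
move=> hu; pose c : U := (2^-1 ^+ n)%:A; pose scale (a : U) (t : V) := a *: t.
exact: (etrans (act_singular_op u) (etrans (congr1 (scale c) hu) (scaler0 V c))).
Qed.

Lemma act_sum (I : Type) (r : seq I) (P : pred I) (u : I -> affine F l) :
  (forall i, P i -> act (u i) w = 0) -> act (\sum_(i <- r | P i) u i) w = 0.
Proof.
move=> h; elim/big_rec: _ => [|i v Pi hv].
  by rewrite /act linear0 scale0r.
rewrite /act linearD scalerDl; have := h i Pi; rewrite /act => ->.
by rewrite add0r; exact: hv.
Qed.

Lemma mode_sum (I : Type) (r : seq I) (P : pred I) (x : I -> g) m :
  mode (\sum_(i <- r | P i) x i) m = \sum_(i <- r | P i) mode (x i) m.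
Proof.
have m0 : mode 0 m = 0 :> affine F l by rewrite /mode monalgU0.
have mD (y z : g) : mode (y + z) m = mode y m + mode z m.
  by have := modeP 1 y z m; rewrite !scale1r.
by elim/big_ind2: _ => // y u z v <- <-; rewrite mD.
Qed.

Lemma singular_op_singular : (0 < n)%N -> singular w.
Proof.
move=> n0; split.
- exact (@singular_op_power_neq0 F l k i1 i2 n char0 i12).
- exists sv_weight, k; split=> [h|].
    exact/act_singular_op_scalar/quad_vacuum_cartan.
  exact/act_singular_op_scalar/quad_vacuum_central.
- move=> x [y [z [hyz ->]]].
  rewrite mode_sum; apply: act_sum => i _; rewrite mode_sum; apply: act_sum => j ij.
  have [hy hz] := hyz i j ij.
  have [yp y0] : parabolic i1 (y i j) /\ so_val (y i j) o o = 0.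
    by apply: (@nplus_root_space true i j _ ij) => h; rewrite hy expr1 mulN1r.
  have [zp z0] : parabolic i1 (z i j) /\ so_val (z i j) o o = 0.
    by apply: (@nplus_root_space false i j _ ij) => h; rewrite hz expr0 mul1r.
  have yzE a b : so_val (y i j + z i j) a b = so_val (y i j) a b + so_val (z i j) a b.
    by rewrite -[so_val (_ + _)]/(so_val (y i j) + so_val (z i j)) mxE.
  apply: act_singular_op0; apply: quad_vacuum_parabolic.
    by move=> a ao; rewrite yzE yp // zp // addr0.
  by rewrite yzE y0 z0 addr0.
move=> p hp.
have -> : ((p, 0) : affine F l) = \sum_(m <- msupp p) mode p@_m m.
  rewrite {1}[p]monalgE; elim/big_ind2: _ => // q1 u1 q2 u2 <- <-.
  by congr (_, _); rewrite addr0.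
rewrite big_seq; apply: act_sum => m hm; apply: act_singular_op0.
apply: quad_vacuum_pos => //; rewrite -gtz0_ge1 ltNge; apply/negP => m0.
by move: hm; rewrite -mcoeff_neq0 hp ?eqxx.
Qed.
End SingularVector.

Theorem theorem3p1 (R : realType) (l : nat) (hl : (4 <= l)%N)
    (n : nat) (hn : (0 < n)%N) :
  let k : R[i] := n%:R - l%:R + 1 in
  singular (singular_op R[i] (first_index hl) ^+ n *: vacuum l k).
Proof.
have char0 m : m.+1%:R != 0 :> R[i] by rewrite pnatr_eq0.
have l1 : (1 < l)%N by exact: leq_trans hl.
exact: (@singular_op_singular _ _ char0 (first_index hl) (Ordinal l1)).
Qed.
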